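(* Let $\mathcal{D}$ be a diagram, i.e. a finite multiset of subsets of $[n]$. If $\mathcal{D}$ is strongly separated, then the Schubitope $\mathcal{S}_{\mathcal{D}}\subseteq\mathbb{R}^n$ is an MV polytope.
   Context: A diagram $\mathcal{D}=\{C_1,\dots,C_k\}$ is a finite multiset of subsets of $[n]$. It is strongly separated if for any two $C_1,C_2\in\mathcal{D}$ we have $(C_1\setminus C_2)\le_{elt}(C_2\setminus C_1)$ or $(C_2\setminus C_1)\le_{elt}(C_1\setminus C_2)$, where $A\le_{elt}B$ means every element of $A$ is smaller than every element of $B$ (vacuously true if $A$ or $B$ is empty). Schubitope: let $S_1,\dots,S_m$ be the distinct sets occurring in $\mathcal{D}$, with multiplicities $a_1,\dots,a_m$. Let $\operatorname{Gr}(\mathcal{D})=\operatorname{Gr}(|S_1|,n)\times\cdots\times\operatorname{Gr}(|S_m|,n)$ (Grassmannians of subspaces of $\mathbb{C}^n$), and let $z_{S_i}\in\operatorname{Gr}(|S_i|,n)$ be the coordinate subspace spanned by the standard basis vectors indexed by $S_i$ (the torus-fixed point whose only non-vanishing Plücker coordinate is $p_{S_i}$). Let $B\subseteq \mathrm{GL}_n(\mathbb{C})$ be the Borel subgroup of upper triangular matrices, acting on subspaces of $\mathbb{C}^n$ in the natural way, and let $\mathcal{F}_{\mathcal{D}}^B$ be the closure of the $B$-orbit of $z_{\mathcal{D}}=(z_{S_1},\dots,z_{S_m})$ in $\operatorname{Gr}(\mathcal{D})$. Let $\mathcal{L}_{\mathcal{D}}$ be the pullback to $\mathcal{F}_{\mathcal{D}}^B$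 of the line bundle $\mathcal{O}(a_1,\dots,a_m)$ on $\operatorname{Gr}(\mathcal{D})$, where $\mathcal{O}(1)$ on each Grassmannian is the (equivariant) dual of the top exterior power of the tautological subbundle. The dual flagged Weyl module is the $B$-module $H^0(\mathcal{F}_{\mathcal{D}}^B,\mathcal{L}_{\mathcal{D}})^*$, and $\chi_{\mathcal{D}}\in\mathbb{Z}[x_1,\dots,x_n]$ denotes its character, i.e. the trace of $\operatorname{diag}(x_1,\dots,x_n)$. For a polynomial $f=\sum_{\alpha\in\mathbb{N}^n}c_\alpha x^\alpha$, $\operatorname{Newton}(f)=\operatorname{conv}(\alpha:c_\alpha\neq0)\subseteq\mathbb{R}^n$. The Schubitope is $\mathcal{S}_{\mathcal{D}}=\operatorname{Newton}(\chi_{\mathcal{D}})$. A generalized permutahedron on $[n]$ is a polytope $P\subseteq\mathbb{R}^n$ such that every edge of $P$ is parallel to a vector $e_i-e_j$ with $i\neq j$ (points are allowed), where $e_1,\dots,e_n$ is the standard basis. It is a lattice generalized permutahedron if all its vertices lie in $\mathbb{Z}^n$. Its supermodular function is $\mu^P(S)=\min_{x\in P}\sum_{i\in S}x_i$ for $S\subseteq[n]$. A lattice generalized permutahedron $P$ is a Mirković–Vilonen (MV) polytope on $[n]$ if for all $S\subseteq[n]$ and all $a<b<c$ in $[n]\setminus S$, $$\mu^P(S\cup\{b\})+\mu^P(S\cup\{a,c\})=\min\bigl(\mu^P(S\cup\{a\})+\mu^P(S\cup\{b,c\}),\ \mu^P(S\cup\{a,b\})+\mu^P(S\cup\{c\})\bigr).$$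 *)

(* Defs.v *)
From HB Require Import structures.
From mathcomp Require Import all_boot all_order all_algebra.
From mathcomp Require Import finmap multiset.
From mathcomp Require Import boolp classical_sets functions reals.
From mathcomp Require Import complex.
From mathcomp Require Import mpoly.

Set Implicit Arguments.
Unset Strict Implicit.
Unset Printing Implicit Defensive.

Import Order.TTheory GRing.Theory Num.Theory.

Local Open Scope mset_scope.
Local Open Scope classical_set_scope.
Local Open Scope ring_scope.

Definition elt_le n (A B : {set 'I_n}) : Prop :=
  forall a b : 'I_n, a \in A -> b \in B -> (a < b)%N.

(* A diagram is a multiset [D : {mset {set 'I_n}}]: [D S] is the multiplicity
   of [S], and [finsupp D] is the set of distinct members of [D].  The set
   {1, ..., n} is modelled by ['I_n] = {0, ..., n-1}. *)
Definition strongly_separated n (D : {mset {set 'I_n}}) : Prop :=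
  forall S T : {set 'I_n}, S \in D -> T \in D ->
    elt_le (S :\: T) (T :\: S) \/ elt_le (T :\: S) (S :\: T).

Section Dual.
Variable K : fieldType.
Implicit Types U V : lmodType K.

(* [V] is finite dimensional and the endomorphism [f] has trace [c]. *)
Definition is_trace V (f : V -> V) (c : K) : Prop :=
  exists N (e : 'I_N -> V) (A : 'M[K]_N),
  [/\ forall v, exists! x : 'rV[K]_N, v = \sum_i x 0 i *: e i,
      forall j, f (e j) = \sum_i A i j *: e i
    & c = \tr A].

Definition is_functional U : {pred U -> K^o} := fun phi => `[< linear phi >].

Fact is_functional_submod_closed U : submod_closed (@is_functional U).
Proof.
split.
  by apply/asboolP => a u v /=; rewrite /cst /= /GRing.zero /= scaler0 addr0.
move=> a f g /asboolP lf /asboolP lg; apply/asboolP => b u v.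
rewrite !fctE lf lg !scalerDr !scalerA (mulrC a b).
by rewrite -!addrA; congr (_ + _); rewrite addrCA.
Qed.

HB.instance Definition _ U :=
  GRing.isSubmodClosed.Build K (U -> K^o) (@is_functional U)
    (@is_functional_submod_closed U).

Record dual U := Dual {
  dual_fun :> U -> K^o;
  dual_funP : dual_fun \in @is_functional U }.

HB.instance Definition _ U := [isSub for @dual_fun U].
HB.instance Definition _ U := [Choice of dual U by <:].
HB.instance Definition _ U := [SubChoice_isSubLmodule of dual U by <:].
End Dual.

Section FlaggedWeyl.
Variables (R : realType) (n : nat) (D : {mset {set 'I_n}}).
Local Notation C := R[i].

(* A point of Gr(k, n) is the row space of a k x n matrix of rank k.  We work
   with the matrices themselves: [frame] is the affine space of families of
   matrices indexed by the distinct members of [D], and the families satisfying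
   [is_frame] form the GL_{k_1} x ... x GL_{k_m}-torsor of bases over Gr(D). *)
Definition frame : Type :=
  forall S : finsupp D, 'M[C]_(#|fsval S|, n).

Definition is_frame (M : frame) : Prop := forall S, row_free (M S).

Definition same_point (M N : frame) : Prop := forall S, (M S == N S)%MS.

(* Row vectors are transposed column vectors, so [g] maps the row [v] to
   [v *m g^T]. *)
Definition gact (g : 'M[C]_n) (M : frame) : frame := fun S => M S *m g^T.

Definition frame_coord : finType :=
  {S : finsupp D & 'I_(#|fsval S|) * 'I_n}%type.

Definition frame_entries (M : frame) (k : 'I_#|frame_coord|) : C :=
  let x : frame_coord := enum_val k in
  M (tag x) (tagged x).1 (tagged x).2.

Definition frame_poly := {mpoly C[#|frame_coord|]}.

Definition peval (p : frame_poly) (M : frame) : C := p.@[frame_entries M].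

Record borel := Borel {
  borel_mx :> 'M[C]_n;
  borelP : (borel_mx \in unitmx) && is_trig_mx borel_mx^T }.

Definition z_frame : frame :=
  fun S => \matrix_(r, c) (c == enum_val r)%:R.

Definition orbit : set frame :=
  [set M | exists b : borel, same_point M (gact b z_frame)].

(* The bases of the points of the orbit closure.  Since the torsor of bases
   carries Gr(D) as a quotient, the Zariski closure of the preimage of a set is
   the preimage of its Zariski closure. *)
Definition orbit_closure : set frame :=
  [set M | is_frame M /\
    forall p, (forall N, orbit N -> peval p N = 0) -> peval p M = 0].

(* A section of L_D at the point (V_S) is an element of the tensor product of
   the spaces (Lambda^top V_S)^* to the power [D S].  It is given by its values
   on the bases [M] of (V_S), so that changing the basis by [g] multiplies it by
   the product of the [\det (g S) ^+ D S]; it is regular when it is, Zariski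
   locally, a quotient of polynomials. *)
Definition is_section : {pred orbit_closure -> C^o} := fun s => `[<
  (forall (M N : orbit_closure) (g : forall S : finsupp D, 'M[C]_#|fsval S|),
     (forall S, val N S = g S *m val M S) ->
     s N = (\prod_S \det (g S) ^+ D (fsval S)) * s M)
  /\
  (forall M0 : orbit_closure, exists p q : frame_poly,
     peval q (val M0) != 0 /\
     forall M : orbit_closure, peval q (val M) != 0 ->
       s M = peval p (val M) / peval q (val M)) >].

Fact is_section_submod_closed : submod_closed is_section.
Proof.
split.
  apply/asboolP; split=> [M N g _|M0]; first by rewrite mulr0.
  exists 0, 1; rewrite /peval rmorph1 oner_eq0; split=> // M _.
  by rewrite rmorph0 mul0r.
move=> a s t /asboolP[es rs] /asboolP[et rt]; apply/asboolP; split.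
  move=> M N g gMN; rewrite !fctE (es _ _ _ gMN) (et _ _ _ gMN) mulrDr.
  by congr (_ + _); rewrite /GRing.scale /= mulrCA.
move=> M0; have [p [q [q0 pq]]] := rs M0; have [p' [q' [q'0 pq']]] := rt M0.
exists (a *: (p * q') + p' * q), (q * q').
rewrite /peval in q0 pq q'0 pq' *.
split=> [|M]; first by rewrite mevalM mulf_neq0.
rewrite mevalM mulf_eq0 negb_or => /andP[qM q'M].
rewrite !fctE pq // pq' // mevalD mevalZ !mevalM /GRing.scale /=.
by rewrite !mulrA addf_div.
Qed.

HB.instance Definition _ :=
  GRing.isSubmodClosed.Build C (orbit_closure -> C^o) is_section
    is_section_submod_closed.

(* H^0 of the orbit closure with coefficients in L_D. *)
Record sections := Sections {
  section_fun :> orbit_closure -> C^o;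
  sectionP : section_fun \in is_section }.

HB.instance Definition _ := [isSub for section_fun].
HB.instance Definition _ := [Choice of sections by <:].
HB.instance Definition _ := [SubChoice_isSubLmodule of sections by <:].

Lemma gactM (g h : 'M[C]_n) (M : frame) :
  gact g (gact h M) = gact (g *m h) M.
Proof.
by apply: functional_extensionality_dep => S; rewrite /gact trmx_mul mulmxA.
Qed.

Lemma peval_gact (g : 'M[C]_n) (p : frame_poly) :
  exists p' : frame_poly, forall M, peval p' M = peval p (gact g M).
Proof.
pose l (k : 'I_#|frame_coord|) : frame_poly :=
  let x : frame_coord := enum_val k in
  \sum_(c < n) g (tagged x).2 c *:
     'X_(enum_rank (Tagged (fun S : finsupp D => ('I_(#|fsval S|) * 'I_n)%type)
                     ((tagged x).1, c) : frame_coord)).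
exists (p \mPo [tuple l k | k < #|frame_coord|]) => M.
rewrite /peval comp_mpoly_meval; congr meval.
apply/funext => k; rewrite tnth_mktuple /l raddf_sum /frame_entries /gact mxE.
by apply: eq_bigr => c _; rewrite /= mevalZ mevalXU enum_rankK /= mxE mulrC.
Qed.

Fact borel_mul (a b : borel) :
  ((a : 'M_n) *m b \in unitmx) && is_trig_mx (a *m b : 'M_n)^T.
Proof.
case: a b => a /andP[ua ta] [b /andP[ub tb]] /=.
rewrite unitmx_mul ua ub /=; apply/is_trig_mxP => i j ij.
rewrite !mxE big1 // => k _.
have [ki|ik] := leqP k i.
  have /is_trig_mxP/(_ k j) := ta.
  by rewrite mxE => ->; rewrite ?mul0r // (leq_ltn_trans ki ij).
have /is_trig_mxP/(_ i k ik) := tb.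
by rewrite mxE => ->; rewrite mulr0.
Qed.

Fact orbit_closure_gact (b : borel) (M : frame) :
  orbit_closure M -> orbit_closure (gact b M).
Proof.
case=> fM pM; split=> [S|p p0].
  have /andP[ub _] := borelP b.
  by rewrite /row_free /gact mxrankMfree ?row_free_unit ?unitmx_tr //; exact: fM.
have [p' p'E] := peval_gact b p; rewrite -p'E; apply: pM => N [c cN].
rewrite p'E; apply: p0; exists (Borel (borel_mul b c)) => S /=.
rewrite -gactM; have /eqmxP e := cN S.
by apply/eqmxP; exact: eqmxMr.
Qed.

Definition closure_gact (b : borel) (M : orbit_closure) : orbit_closure :=
  SigSub (mem_set (orbit_closure_gact b (set_mem (valP M)))).

Fact is_section_pull (b : borel) (s : sections) :
  (fun M => s (closure_gact b M)) \in is_section.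
Proof.
have /asboolP[es rs] := sectionP s; apply/asboolP; split.
  move=> M N g gMN; apply: es => S /=.
  by rewrite /gact gMN mulmxA.
move=> M0; have [p [q [q0 pq]]] := rs (closure_gact b M0).
have [p' p'E] := peval_gact b p; have [q' q'E] := peval_gact b q.
exists p', q'; rewrite q'E; split=> // M; rewrite p'E q'E => qM.
exact: pq.
Qed.

(* The section [M |-> s (b M)], i.e. [b^-1] acting on [s]. *)
Definition pull (b : borel) (s : sections) : sections :=
  Sections (is_section_pull b s).

Fact is_functional_act (b : borel) (phi : dual sections) :
  (fun s => phi (pull b s)) \in @is_functional _ sections.
Proof.
have /asboolP lphi := dual_funP phi; apply/asboolP => a s t.
by rewrite -lphi; congr (phi _); apply: val_inj.
Qed.

(* The dual flagged Weyl module is [dual sections], with this action of B. *)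
Definition weyl_act (b : borel) (phi : dual sections) : dual sections :=
  Dual (is_functional_act b phi).

Definition is_character (chi : {mpoly int[n]}) : Prop :=
  forall (b : borel) (x : 'rV[C]_n), b = diag_mx x :> 'M_n ->
    is_trace (weyl_act b) (mmap intr (x 0) chi).

(* Junk value 0 if no polynomial is the character. *)
Definition character : {mpoly int[n]} := xget 0 [set chi | is_character chi].

End FlaggedWeyl.

Section Polytopes.
Variables (R : realType) (n : nat).
Implicit Types (A P : set 'rV[R]_n) (S : {set 'I_n}).

Definition conv A : set 'rV[R]_n :=
  [set x | exists N (v : 'I_N -> 'rV[R]_n) (w : 'I_N -> R),
     [/\ forall i, A (v i), forall i, 0 <= w i, \sum_i w i = 1
       & x = \sum_i w i *: v i]].

Definition newton (f : {mpoly int[n]}) : set 'rV[R]_n :=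
  conv [set x | exists2 a : 'X_{1..n}, f@_a != 0 & x = \row_i (a i)%:R].

Definition is_polytope P : Prop :=
  exists N (v : 'I_N.+1 -> 'rV[R]_n), P = conv (range v).

(* The face of [P] on which the linear form [c] is minimal. *)
Definition face P (c : 'rV[R]_n) : set 'rV[R]_n :=
  [set x | P x /\ forall y, P y -> \sum_i c 0 i * x 0 i <= \sum_i c 0 i * y 0 i].

Definition is_vertex P (v : 'rV[R]_n) : Prop :=
  exists c, face P c = [set v].

Definition is_edge P (u v : 'rV[R]_n) : Prop :=
  u != v /\ exists c, face P c = conv [set u; v].

Definition generalized_permutahedron P : Prop :=
  is_polytope P /\
  forall u v, is_edge P u v -> exists (i j : 'I_n) (t : R),
    i != j /\ v - u = t *: (delta_mx 0 i - delta_mx 0 j).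

Definition lattice_generalized_permutahedron P : Prop :=
  generalized_permutahedron P /\
  forall v, is_vertex P v -> forall i, v 0 i \is a Num.int.

(* The infimum is attained when [P] is a polytope. *)
Definition mu P S : R := inf [set \sum_(i in S) x 0 i | x in P].

Definition MV_polytope P : Prop :=
  lattice_generalized_permutahedron P /\
  forall (S : {set 'I_n}) (a b c : 'I_n),
    a \notin S -> b \notin S -> c \notin S -> (a < b)%N -> (b < c)%N ->
    mu P (b |: S) + mu P (S :|: [set a; c]%SET) =
    Num.min (mu P (a |: S) + mu P (S :|: [set b; c]%SET))
            (mu P (S :|: [set a; b]%SET) + mu P (c |: S)).
End Polytopes.

Definition schubitope (R : realType) n (D : {mset {set 'I_n}}) :
    set 'rV[R]_n :=
  newton (character R D).

Arguments schubitope R {n} D.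

(* Main.v *)
(* No vanishing theorem is needed.  A section s over the orbit closure is studied
   along curves of the closure, on which it is a polynomial.  For an exponent
   vector c the curve t ^ c M extends to t = 0 after rescaling a basis adapted to
   c (the pivots of M), and the rescaling factor bounds from below the order in t
   of s (t ^ c M) by the minimum of c over the sets I <= S, summed over the S in
   D.  This bounds all weights of sections; conjugating by the torus, it also
   bounds the degree of s along root subgroups, so that s is determined by its
   values on a finite grid of unitriangular matrices.  Hence the space of
   sections has a finite basis of weight vectors.  Conversely every choice of
   sets I_k <= S_k, one for each copy S_k in D, is the weight of a product of
   minors.  So the Schubitope is a Minkowski sum of Schubert matroid polytopes:
   its edges come from symmetric exchange and mu is the sum over the copies of
   max_j (|S_k /\ [j]| - |[j] \ T|).  Each summand satisfies the tropical Pluecker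
   relation, and strong separation forces all of them to attain the minimum on
   the same side. *)
From HB Require Import structures.
Require Import Defs.
From mathcomp Require Import all_boot all_order all_algebra.
From mathcomp Require Import perm finmap multiset.
From mathcomp Require Import boolp classical_sets reals.
From mathcomp Require Import complex mpoly.
From mathcomp Require Import zify ring.

Set Implicit Arguments.
Unset Strict Implicit.
Unset Printing Implicit Defensive.

(* [classical_sets] shadows the finite sets of [finset]. *)
Import fintype boot.finset Order.TTheory GRing.Theory Num.Theory.

Local Open Scope mset_scope.
Local Open Scope ring_scope.

(** * Polynomials and linear algebra *)

(** [character] is 0 unless some polynomial computes all torus traces, and [is_trace] asks for a
    finite basis. So the finite dimension of the space of sections has to be proved, starting from
    functions that are only locally rational. Two facts about the affine line carry this: a function
    that is locally a quotient of polynomials is a polynomial, and a polynomial identity valid for t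
    != 0 holds at t = 0. The second one puts limits of curves into the orbit closure. Upper bounds
    on degrees come from lower bounds on orders at 0 by passing from t to t^-1. On the polyhedral
    side, weights of sections are compared with weights of families I_k only through linear forms
    with natural coefficients. All these weights have the same degree, so adding a constant to all
    coefficients of a form is harmless. Scaling, rounding and a small tilt then give the comparison
    for real forms, which is what faces and edges require. *)

Lemma eq_poly_off0 (F : numDomainType) (p q : {poly F}) :
  (forall t, t != 0 -> p.[t] = q.[t]) -> p = q.
Proof.
move=> pq; apply/eqP; rewrite -subr_eq0; apply/eqP.
apply: (@roots_geq_poly_eq0 _ _ [seq i.+1%:R | i <- iota 0 (size (p - q))]).
- apply/allP => _ /mapP[i _ ->].
  by rewrite /root hornerD hornerN pq ?subrr // pnatr_eq0.
- by rewrite map_inj_uniq ?iota_uniq // => i j /eqP; rewrite eqr_nat => /eqP[].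
- by rewrite size_map size_iota.
Qed.

Lemma exists_nonroot (F : numDomainType) (p : {poly F}) :
  p != 0 -> exists2 t, t != 0 & p.[t] != 0.
Proof.
move=> /eqP p0; apply: contrapT => h; apply: p0; apply: eq_poly_off0 => t t0.
by rewrite horner0; apply/eqP; apply: contrapT => /negP pt; apply: h; exists t.
Qed.

(** Reduce the quotient at 0 to lowest terms P' / Q'. Any other local quotient p / q satisfies p *
    Q' = P' * q, so at a root of Q' where q is nonzero P' would vanish too, against coprimality.
    Over a closed field Q' is therefore constant. *)
Lemma locally_rational_poly (F : numClosedFieldType) (f : F -> F) :
  (forall t0, exists P Q : {poly F}, Q.[t0] != 0 /\
     forall t, Q.[t] != 0 -> f t = P.[t] / Q.[t]) ->
  exists P : {poly F}, forall t, f t = P.[t].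
Proof.
move=> fP; have [P [Q [Q0 fPQ]]] := fP 0.
have Qn0 : Q != 0 by apply: contraNneq Q0 => ->; rewrite horner0.
pose g := gcdp P Q; pose P' := P %/ g; pose Q' := Q %/ g.
have gn0 : g != 0 by rewrite gcdp_eq0 negb_and Qn0 orbT.
have EP : P = P' * g by rewrite divpK // dvdp_gcdl.
have EQ : Q = Q' * g by rewrite divpK // dvdp_gcdr.
have cop : coprimep P' Q' by rewrite coprimep_div_gcd // Qn0 orbT.
have cross p q : q != 0 -> (forall t, q.[t] != 0 -> f t = p.[t] / q.[t]) ->
    p * Q' = P' * q.
  move=> qn0 fpq; apply: (mulIf gn0); rewrite -mulrA -EQ mulrAC -EP.
  (* The factor q * Q makes both sides vanish at the points where one of the two quotients says
     nothing about f. *)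
  apply: (mulIf (mulf_neq0 qn0 Qn0)); apply: eq_poly_off0 => t _.
  rewrite !hornerM; have [->|qt] := eqVneq q.[t] 0; first by rewrite !(mul0r, mulr0).
  have [->|Qt] := eqVneq Q.[t] 0; first by rewrite !(mul0r, mulr0).
  by congr (_ * _); apply/eqP; rewrite -eqr_div // -fpq // -fPQ.
have sQ : size Q' == 1.
  apply: contraT => /closed_rootP[x Qx]; have [p [q [q0 fpq]]] := fP x.
  have qn0 : q != 0 by apply: contraNneq q0 => ->; rewrite horner0.
  have /(congr1 (horner^~ x)) := cross p q qn0 fpq.
  rewrite !hornerM (rootP Qx) mulr0 => /esym/eqP; rewrite mulf_eq0 (negPf q0) orbF.
  by rewrite (negPf (coprimep_root _ Qx)) // coprimep_sym.
have /size_poly1P[c c0 Qc] := sQ.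
exists (c^-1 *: P') => t; have [p [q [q0 fpq]]] := fP t.
have qn0 : q != 0 by apply: contraNneq q0 => ->; rewrite horner0.
have /(congr1 (horner^~ t)) := cross p q qn0 fpq.
rewrite fpq // hornerZ Qc !hornerM hornerC => e.
by rewrite [RHS]mulrC; apply/eqP; rewrite eqr_div // e.
Qed.

(** With r the reversal of q, of degree at most e, the hypothesis becomes p * 'X^e = r * 'X^d, and
    sizes are compared. *)
Lemma size_poly_inv (F : numFieldType) (d : nat) (p q : {poly F}) :
  (forall t, t != 0 -> p.[t] = t ^+ d * q.[t^-1]) -> (size p <= d.+1)%N.
Proof.
move=> pq; pose e := size q; pose r := \poly_(i < e.+1) q`_(e - i).
have rE t : t != 0 -> r.[t] = t ^+ e * q.[t^-1].
  move=> t0; rewrite horner_poly (@horner_coef_wide _ e.+1) // mulr_sumr.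
  rewrite (reindex_inj rev_ord_inj) /=; apply: eq_bigr => i _.
  have ie : (i <= e)%N by rewrite -ltnS.
  rewrite subSS subKn // mulrCA; congr (_ * _).
  by rewrite exprVn expfB_cond // (negPf t0).
have [->|p0] := eqVneq p 0; first by rewrite size_poly0.
have E : p * 'X^e = r * 'X^d.
  apply: eq_poly_off0 => t t0; rewrite !hornerM !hornerXn pq // rE //.
  by ring.
have r0 : r != 0.
  apply: contra_neq p0 => r0; apply/eqP; move/eqP: E.
  by rewrite r0 mul0r mulf_eq0 orbC (negPf (monic_neq0 (monicXn _ _))).
have := congr1 (fun p : {poly F} => size p) E.
rewrite !size_Mmonic ?monicXn // ?size_polyXn.
have := size_poly e.+1 (fun i => q`_(e - i)); rewrite -/r.
by rewrite !addnS /=; lia.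
Qed.

(** Inverse of a Vandermonde matrix. The nodes 1, ..., d + 1 avoid 0, where one-parameter subgroups
    of the torus have no value. *)
Lemma interpolation (F : numFieldType) (d : nat) :
  exists L : 'M[F]_d.+1, forall p : {poly F}, (size p <= d.+1)%N ->
    forall k : 'I_d.+1, p`_k = \sum_m L m k * p.[m.+1%:R].
Proof.
pose a : 'rV[F]_d.+1 := \row_m m.+1%:R; pose V := Vandermonde d.+1 a.
have Vu : V \in unitmx.
  rewrite unitmxE det_Vandermonde unitfE; apply/prodf_neq0 => i _.
  apply/prodf_neq0 => j ij; rewrite !mxE subr_eq0 eqr_nat eqSS.
  by rewrite gtn_eqF.
exists (invmx V) => p sp k; pose P : 'rV[F]_d.+1 := \row_i p`_i.
have : P *m V *m invmx V = P by rewrite mulmxK.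
move=> /rowP/(_ k); rewrite [RHS]mxE => <-; rewrite mxE; apply: eq_bigr => m _.
rewrite mulrC (horner_coef_wide _ sp) mxE; congr (_ * _).
by apply: eq_bigr => i _; rewrite !mxE.
Qed.

(** Among the invertible maximal minors take one of least total weight c. If the normalized matrix
    has a nonzero entry at (r, j), replacing the pivot [f r] by j gives another invertible minor, so
    minimality yields c (f r) <= c j. *)
Lemma pivots (F : fieldType) k n (M : 'M[F]_(k, n)) (c : 'I_n -> nat) :
  row_free M -> exists f : 'I_k -> 'I_n, colsub f M \in unitmx /\
    forall r j, (invmx (colsub f M) *m M) r j != 0 -> (c (f r) <= c j)%N.
Proof.
move=> Mf; have MT : row_full M^T by rewrite /row_full mxrank_tr.
pose P (f : {ffun 'I_k -> 'I_n}) := colsub f M \in unitmx.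
have P0 : P [ffun r => fullrankfun MT r].
  rewrite /P -unitmx_tr.
  have := fullrowsub_unit MT; congr (_ \in unitmx).
  by apply/matrixP => i j; rewrite !mxE [in RHS]ffunE.
have [f Pf fmin] := arg_minnP (fun f : {ffun 'I_k -> 'I_n} => \sum_r c (f r))%N P0.
exists f; split=> // r j; set N := _ *m M => Nrj.
have EN : colsub f N = 1%:M.
  have -> : colsub f N = invmx (colsub f M) *m colsub f M.
    by apply/matrixP => x y; rewrite !mxE; apply: eq_bigr => z _; rewrite !mxE.
  by rewrite mulVmx.
pose f' := [ffun x => if x == r then j else f x].
have Pf' : P f'.
  have -> : P f' = (colsub f M *m colsub f' N \in unitmx).
    congr (_ \in unitmx).
    have {1}-> : M = colsub f M *m N by rewrite mulKVmx.
    by apply/matrixP => x y; rewrite !mxE; apply: eq_bigr => z _; rewrite !mxE.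
  rewrite unitmx_mul (Pf : colsub f M \in unitmx) /= -row_free_unit -kermx_eq0.
    apply/rowV0P => v /sub_kermxP v0.
  have vE y : y != r -> v 0 y = 0.
    move=> yr; have /rowP/(_ y) := v0; rewrite !mxE (bigD1 y) //= big1 ?addr0.
      have /matrixP/(_ y y) := EN; rewrite !mxE eqxx /f' ffunE (negPf yr) => ->.
      by rewrite mulr1.
    move=> z zy; have /matrixP/(_ z y) := EN; rewrite !mxE (negPf zy) ffunE (negPf yr).
    by move=> ->; rewrite mulr0.
  apply/rowP => y; rewrite [RHS]mxE; have [->|/vE//] := eqVneq y r.
  have /rowP/(_ r) := v0; rewrite [LHS]mxE [RHS]mxE (bigD1 r) //= big1 ?addr0.
    rewrite [colsub _ _ _ _]mxE ffunE eqxx => /eqP; rewrite mulf_eq0 => /orP[/eqP//|].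
    by rewrite (negPf Nrj).
  by move=> z /vE ->; rewrite mul0r.
have := fmin f' Pf'; rewrite (bigD1 r) //= [X in (_ <= X)%N](bigD1 r) //=.
rewrite {1}ffunE eqxx [X in (_ <= _ + X)%N](eq_bigr (fun x => c (f x))).
  by rewrite leq_add2r.
by move=> x xr; rewrite ffunE (negPf xr).
Qed.

(** The embedding E bounds the length of independent families in P. A longest one spans every
    element of P, hence V. This will produce a finite basis of weight vectors. *)
Lemma basis_of_span (K : fieldType) (V : lmodType K) m
    (E : {linear V -> 'rV[K]_m}) (P : V -> Prop) :
  injective E ->
  (forall v, exists2 s : seq V, forall x, x \in s -> P x & v = \sum_(x <- s) x) ->
  exists N (e : 'I_N -> V), (forall j, P (e j)) /\
    forall v, exists! x : 'rV[K]_N, v = \sum_j x 0 j *: e j.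
Proof.
move=> Einj span.
pose A N (e : 'I_N -> V) := \matrix_j E (e j).
pose Q N := `[< exists e : 'I_N -> V, (forall j, P (e j)) /\ row_free (A N e) >].
have exQ : exists N, Q N.
  exists 0; apply/asboolP; exists (fun _ => 0); split; first by case.
  by rewrite /row_free -leqn0 rank_leq_row.
have bQ N : Q N -> (N <= m)%N.
  by move=> /asboolP[e [_ /eqP <-]]; exact: rank_leq_col.
case: (ex_maxnP exQ bQ) => N /asboolP[e [eP ef]] Nmax.
have Ecomb (x : 'rV_N) : E (\sum_j x 0 j *: e j) = x *m A N e.
  rewrite linear_sum mulmx_sum_row; apply: eq_bigr => j _.
  by rewrite linearZ /= rowK.
exists N, e; split=> // v.
have Psub u : P u -> (E u <= A N e)%MS.
  move=> Pu; apply: contraT => nu.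
  suff /Nmax : Q N.+1 by rewrite ltnn.
  pose e1 (i : 'I_(1 + N)) := if split i is inr j then e j else u.
  apply/asboolP; exists e1; split=> [i|].
    by rewrite /e1; case: (split (i : 'I_(1 + N))).
  have -> : A N.+1 e1 = col_mx (E u) (A N e).
    apply/matrixP => i j; rewrite [LHS]mxE [RHS]mxE /e1.
    by case: split => k; rewrite ?mxE // zmodp.ord1.
  have lt : (A N e < E u + A N e)%MS.
    by rewrite ltmxE addsmxSr /= addsmx_sub (negPf nu).
  have := rank_ltmx lt; rewrite (eqP ef) addsmxE => h.
  by rewrite /row_free eqn_leq rank_leq_row.
have /submxP[x xE] : (E v <= A N e)%MS.
  have [s sP ->] := span v; rewrite linear_sum big_seq.
  by apply: summx_sub => w /sP; exact: Psub.
exists x; split; first by apply: Einj; rewrite Ecomb.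
move=> y yE; apply: (row_free_inj ef); rewrite -xE -Ecomb; congr (E _).
by rewrite -yE.
Qed.

(** The two bases are not assumed to have the same size. The changes of basis are rectangular
    matrices inverse to each other on both sides, and tr (X Y) = tr (Y X) holds for these as
    well. *)
Lemma is_trace_uniq (K : fieldType) (V : lmodType K) (f : {linear V -> V}) c d :
  is_trace f c -> is_trace f d -> c = d.
Proof.
move=> [N [e [A [eb fA ->]]]] [N' [e' [B [eb' fB ->]]]].
have inj M (g : 'I_M -> V) (gb : forall v, exists! x : 'rV_M, v = \sum_i x 0 i *: g i)
    (x y : 'rV_M) : \sum_i x 0 i *: g i = \sum_i y 0 i *: g i -> x = y.
  move=> xy; have [z [_ zu]] := gb (\sum_i x 0 i *: g i).
  by rewrite -(zu x) // -(zu y).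
have comp M M' p (g : 'I_M -> V) (X : 'M_(M', M)) (Y : 'M_(p, M')) l :
    \sum_j Y l j *: (\sum_i X j i *: g i) = \sum_i (Y *m X) l i *: g i.
  under eq_bigr do rewrite scaler_sumr; rewrite exchange_big /=.
  apply: eq_bigr => i _; rewrite mxE scaler_suml; apply: eq_bigr => j _.
  by rewrite scalerA.
have injM M M' (g : 'I_M -> V) (gb : forall v, exists! x : 'rV_M, v = \sum_i x 0 i *: g i)
    (X Y : 'M_(M', M)) :
    (forall l, \sum_i X l i *: g i = \sum_i Y l i *: g i) -> X = Y.
  move=> XY; apply/row_matrixP => l; apply: (inj _ _ gb).
  by under eq_bigr do rewrite mxE; under [RHS]eq_bigr do rewrite mxE.
have coord M M' (g : 'I_M -> V) (h : 'I_M' -> V)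
    (gb : forall v, exists! x : 'rV_M, v = \sum_i x 0 i *: g i) :
    exists P : 'M_(M', M), forall j, h j = \sum_i P j i *: g i.
  have /choice[x xE] j : exists x : 'rV_M, h j = \sum_i x 0 i *: g i.
    by have [x [xE _]] := gb (h j); exists x.
  exists (\matrix_j x j) => j; rewrite xE; apply: eq_bigr => i _.
  by rewrite mxE.
have one M (g : 'I_M -> V) l : g l = \sum_i (1%:M : 'M_M) l i *: g i.
  rewrite (bigD1 l) //= big1 ?addr0 ?mxE ?eqxx ?scale1r // => i il.
  by rewrite mxE eq_sym (negPf il) scale0r.
have [P PE] := coord N N' e e' eb; have [Q QE] := coord N' N e' e eb'.
have QP : Q *m P = 1%:M.
  apply: (injM _ _ _ eb) => l; rewrite -one -comp (QE l).
  by apply: eq_bigr => j _; rewrite -PE.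
have PQ : P *m Q = 1%:M.
  apply: (injM _ _ _ eb') => l; rewrite -one -comp (PE l).
  by apply: eq_bigr => j _; rewrite -QE.
have PA : P *m A^T = B^T *m P.
  apply: (injM _ _ _ eb) => l; transitivity (f (e' l)).
    rewrite (PE l) linear_sum -comp; apply: eq_bigr => j _.
    by rewrite linearZ /= fA; congr (_ *: _); apply: eq_bigr => i _; rewrite mxE.
  rewrite fB -comp; apply: eq_bigr => j _.
  by rewrite -PE mxE.
rewrite -mxtrace_tr -[A^T]mul1mx -QP -mulmxA PA mxtrace_mulC -mulmxA PQ mulmx1.
by rewrite mxtrace_tr.
Qed.

Lemma digits_inj K n (a b : 'I_n -> nat) :
  (forall i, a i < K)%N -> (forall i, b i < K)%N ->
  (\sum_i a i * K ^ i = \sum_i b i * K ^ i)%N -> a =1 b.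
Proof.
elim: n a b => [|n IH] a b aK bK; first by move=> _ [].
have K0 : (0 < K)%N by apply: leq_ltn_trans (aK ord0).
rewrite !big_ord_recl !expn0 !muln1.
have shift (c : 'I_n.+1 -> nat) :
    (\sum_(i < n) c (lift ord0 i) * K ^ lift ord0 i =
     (\sum_(i < n) c (lift ord0 i) * K ^ i) * K)%N.
  by rewrite big_distrl; apply: eq_bigr => i _ /=; rewrite expnSr mulnA.
rewrite !shift => e.
have e0 : a ord0 = b ord0.
  have := congr1 (modn^~ K) e.
  by rewrite /= ![(a _ + _)%N]addnC ![(b _ + _)%N]addnC !modnMDl !modn_small.
move: e; rewrite e0 => /addnI/eqP; rewrite eqn_pmul2r // => /eqP e i.
have [j ->|->//] := unliftP ord0 i.
exact: (IH (fun i => a (lift ord0 i)) (fun i => b (lift ord0 i))).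
Qed.

(* Kronecker substitution [x_i = t ^ (K ^ i)] *)
Lemma mpoly_off0 (F : numDomainType) n (f : {mpoly F[n]}) :
  (forall x : 'I_n -> F, (forall i, x i != 0) -> f.@[x] = 0) -> f = 0.
Proof.
move=> f0; apply/mpolyP => m; rewrite mcoeff0; apply: contrapT => /eqP.
rewrite -mcoeff_msupp => mf.
(* K exceeds every exponent of f, so h is injective on the support by uniqueness of digits. *)
pose K := msize f; pose h (m : 'X_{1..n}) := (\sum_i m i * K ^ i)%N.
have lt (m' : 'X_{1..n}) i : m' \in msupp f -> (m' i < K)%N.
  move=> /msize_mdeg_lt; apply: leq_ltn_trans.
  by rewrite mdegE (bigD1 i) //= leq_addr.
have : \sum_(m <- msupp f) f@_m *: 'X^(h m) = 0 :> {poly F}.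
  apply: eq_poly_off0 => t t0; rewrite horner0.
  rewrite -(f0 (fun i => t ^+ (K ^ i))) => [|i]; last exact: expf_neq0.
  rewrite mevalE horner_sum; apply: eq_bigr => m' _.
  rewrite hornerZ hornerXn expr_sum; congr (_ * _); apply: eq_bigr => i _.
  by rewrite -exprM mulnC.
move=> /(congr1 (fun p : {poly F} => p`_(h m))); rewrite coef0 coef_sum.
rewrite (bigD1_seq m) ?msupp_uniq //= coefZ coefXn eqxx mulr1 big_seq_cond big1.
  by rewrite addr0 => /eqP; rewrite mcoeff_eq0 mf.
move=> m' /andP[m'f mm']; rewrite coefZ coefXn; case: eqP => [e|_]; last by rewrite mulr0.
case/eqP: mm'; apply/mnmP => i; symmetry; move: i.
by apply: (@digits_inj K) => // i; exact: lt.
Qed.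

Lemma row_free_mulr (F : fieldType) k n (A : 'M[F]_(k, n)) (B : 'M_(n, k)) :
  A *m B \in unitmx -> row_free A.
Proof.
rewrite -row_free_unit /row_free => /eqP e.
by rewrite eqn_leq rank_leq_row -{1}e mxrankM_maxl.
Qed.

Lemma choice_dep (A : Type) (B : A -> Type) (P : forall a, B a -> Prop) :
  (forall a, exists b, P a b) -> exists f : forall a, B a, forall a, P a (f a).
Proof.
move=> h; exists (fun a => projT1 (cid (h a))) => a.
exact: projT2 (cid (h a)).
Qed.

(** * Sections along curves of the orbit closure *)

Section Geometry.
Variables (R : realType) (n : nat) (D : {mset {set 'I_n}}).
Local Notation C := R[i].
Local Notation frame := (frame R D).
Local Notation clos := (@orbit_closure R n D).
Local Notation orbit := (@Defs.orbit R n D).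
Local Notation section := (sections R D).
Implicit Types (M N : frame) (s : section) (p q : frame_poly R D) (t : C).

(* A section as a function on all frames, with junk value 0 off the closure. *)
Definition ev s M : C := if insub M is Some X then s (X : clos) else 0.

Lemma evE s (X : clos) : ev s (val X) = s X.
Proof. by rewrite /ev valK. Qed.

Lemma closP M : clos M -> exists X : clos, val X = M.
Proof. by move=> cM; exists (SigSub (mem_set cM)). Qed.

Lemma clos_val (X : clos) : clos (val X).
Proof. exact: set_mem (valP X). Qed.

Lemma ev_rebase s M N (g : forall S : finsupp D, 'M[C]_#|fsval S|) :
  clos M -> clos N -> (forall S, N S = g S *m M S) ->
  ev s N = (\prod_S \det (g S) ^+ D (fsval S)) * ev s M.
Proof.
move=> /closP[X <-] /closP[Y <-] gXY; rewrite !evE.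
by have /asboolP[+ _] := sectionP s; apply.
Qed.

Lemma ev_local s M0 : clos M0 -> exists p q, peval q M0 != 0 /\
  forall M, clos M -> peval q M != 0 -> ev s M = peval p M / peval q M.
Proof.
move=> /closP[X0 <-]; have /asboolP[_ rs] := sectionP s.
have [p [q [q0 pq]]] := rs X0; exists p, q; split=> // M /closP[X <-] qX.
by rewrite evE pq.
Qed.

Lemma ev_pull b s M : clos M -> ev (pull b s) M = ev s (gact b M).
Proof. by move=> /closP[X <-]; rewrite evE [RHS](evE s (closure_gact b X)). Qed.

Lemma evD s s' M : ev (s + s') M = ev s M + ev s' M.
Proof. by rewrite /ev; case: insub => [X|]; rewrite ?addr0 //=. Qed.

Lemma evZ a s M : ev (a *: s) M = a * ev s M.
Proof. by rewrite /ev; case: insub => [X|]; rewrite ?mulr0 //=. Qed.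

Lemma ev0 M : ev 0 M = 0.
Proof. by rewrite -(scale0r 0) evZ mul0r. Qed.

Lemma ev_sum I (r : seq I) (P : pred I) (F : I -> section) M :
  ev (\sum_(i <- r | P i) F i) M = \sum_(i <- r | P i) ev (F i) M.
Proof.
by elim/big_rec2: _ => [|i y1 y2 _ <-]; rewrite ?ev0 ?evD.
Qed.

Lemma ev_inj s s' : (forall M, clos M -> ev s M = ev s' M) -> s = s'.
Proof.
move=> ss'; apply: val_inj; apply/funext => X /=.
by rewrite -!evE ss' //; exact: clos_val.
Qed.

Lemma section_of_poly p :
  (forall M N (g : forall S : finsupp D, 'M[C]_#|fsval S|),
    (forall S, N S = g S *m M S) ->
    peval p N = (\prod_S \det (g S) ^+ D (fsval S)) * peval p M) ->
  exists s, forall M, clos M -> ev s M = peval p M.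
Proof.
move=> ep.
have h : (fun X : clos => peval p (val X)) \in @is_section R n D.
  apply/asboolP; split=> [M N g /ep ->//|M0].
  exists p, 1; rewrite /peval meval1 oner_eq0; split=> // M _.
  by rewrite meval1 divr1.
by exists (Sections h) => M /closP[X <-]; rewrite evE.
Qed.

Definition entry_var (S : finsupp D) (r : 'I_#|fsval S|) (j : 'I_n) :
    frame_poly R D :=
  'X_(enum_rank (Tagged (fun S : finsupp D => ('I_(#|fsval S|) * 'I_n)%type)
       (r, j) : frame_coord D)).

Lemma peval_var (S : finsupp D) r j M : peval (entry_var r j) M = M S r j.
Proof. by rewrite /peval mevalXU /frame_entries enum_rankK. Qed.

Lemma peval_subst (L : frame -> frame) :
  (forall k, exists q, forall M, frame_entries (L M) k = peval q M) ->
  forall p, exists p', forall M, peval p' M = peval p (L M).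
Proof.
move=> /choice[l lE] p; exists (p \mPo [tuple l k | k < #|frame_coord D|]) => M.
rewrite /peval comp_mpoly_meval; congr meval.
by apply/funext => k; rewrite tnth_mktuple lE.
Qed.

(** For invertible g this changes the bases but not the point of Gr(D). *)
Definition lact (g : forall S : finsupp D, 'M[C]_#|fsval S|) M : frame :=
  fun S => g S *m M S.

Lemma orbit_clos M : orbit M -> clos M.
Proof.
move=> oM; split=> [S|p]; last exact.
have [b /(_ S)/eqmxP bM] := oM.
have /andP[ub _] := borelP b.
rewrite /row_free bM /gact mxrankMfree ?row_free_unit ?unitmx_tr //.
suff zz : z_frame R S *m (z_frame R S)^T = 1%:M.
  by apply: (@row_free_mulr _ _ _ _ (z_frame R S)^T); rewrite zz unitmx1.
apply/matrixP => r r'; rewrite !mxE (bigD1 (enum_val r)) //= !mxE eqxx mul1r.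
rewrite big1 ?addr0 => [|j jr]; last by rewrite !mxE (negPf jr) mul0r.
by rewrite (inj_eq enum_val_inj).
Qed.

Lemma clos_lact g M : (forall S, g S \in unitmx) -> clos M -> clos (lact g M).
Proof.
move=> gu [fM pM]; split=> [S|p p0].
  have /row_freeP[B MB] := fM S; apply: (@row_free_mulr _ _ _ _ B).
  by rewrite /lact -mulmxA MB mulmx1.
have [k|p' p'E] := @peval_subst (lact g) _ p.
  exists (\sum_i (g (tag (enum_val k)) (tagged (enum_val k)).1 i) *:
    entry_var i (tagged (enum_val k)).2) => N.
  rewrite /frame_entries /lact mxE /peval raddf_sum; apply: eq_bigr => i _.
  by rewrite /= mevalZ -/(peval _ _) peval_var.
rewrite -p'E; apply: pM => N [b bN]; rewrite p'E; apply: p0; exists b => S.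
apply/eqmxP; apply: eqmx_trans (eqmxP (bN S)); apply: eqmxMfull.
by rewrite row_full_unit.
Qed.

(** If s = p / q near M, then p * q vanishes on the whole orbit, also where q does, and therefore at
    M, where q is nonzero. *)
Lemma section_dense s : (forall M, orbit M -> ev s M = 0) -> s = 0.
Proof.
move=> s0; apply: ev_inj => M cM; rewrite ev0.
have [p [q [q0 pq]]] := ev_local s cM.
have : peval (p * q) M = 0.
  have [_ hM] := cM; apply: hM => N oN.
  have := pq N (orbit_clos oN); rewrite s0 // /peval mevalM -/(peval p N) -/(peval q N).
  have [->|qN] := eqVneq (peval q N) 0; first by rewrite mulr0.
  move=> /(_ isT)/esym/eqP; rewrite mulf_eq0 invr_eq0 (negPf qN) orbF => /eqP ->.
  by rewrite mul0r.
rewrite /peval mevalM => /eqP; rewrite mulf_eq0 (negPf q0) orbF => /eqP pM.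
by rewrite pq // /peval pM mul0r.
Qed.

(** * Polynomial curves and one-parameter subgroups *)

Definition poly_frame := forall S : finsupp D, 'M[{poly C}]_(#|fsval S|, n).

Definition at_param (Mp : poly_frame) t : frame :=
  fun S => map_mx (horner_eval t) (Mp S).

Lemma peval_param p (Mp : poly_frame) :
  exists P : {poly C}, forall t, peval p (at_param Mp t) = P.[t].
Proof.
pose e (k : 'I_#|frame_coord D|) :=
  Mp (tag (enum_val k)) (tagged (enum_val k)).1 (tagged (enum_val k)).2.
exists (mmap polyC e p) => t.
rewrite /peval mevalE /mmap horner_sum; apply: eq_bigr => m _.
rewrite hornerM hornerC /mmap1 horner_prod; congr (_ * _).
apply: eq_bigr => k _; rewrite horner_exp; congr (_ ^+ _).
by rewrite /frame_entries mxE.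
Qed.

Lemma ev_param s (Mp : poly_frame) : (forall t, clos (at_param Mp t)) ->
  exists P : {poly C}, forall t, ev s (at_param Mp t) = P.[t].
Proof.
move=> cM; apply: locally_rational_poly => t0.
have [p [q [q0 pq]]] := ev_local s (cM t0).
have [P PE] := peval_param p Mp; have [Q QE] := peval_param q Mp.
by exists P, Q; rewrite -QE; split=> // t; rewrite -QE -PE; exact: pq.
Qed.

Lemma diag_borelP (x : 'rV[C]_n) : (forall i, x 0 i != 0) ->
  (diag_mx x \in unitmx) && is_trig_mx (diag_mx x)^T.
Proof.
move=> x0; rewrite tr_diag_mx diag_mx_is_trig andbT unitmxE det_diag unitfE.
by apply/prodf_neq0 => i _; exact: x0.
Qed.

Definition off0 t : C := if t == 0 then 1 else t.

Lemma cochar_neq0 (c : 'I_n -> nat) t i : (\row_j off0 t ^+ c j) 0 i != 0.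
Proof.
by rewrite mxE expf_neq0 // /off0; case: ifP => [_|/negbT//]; exact: oner_neq0.
Qed.

(* The one-parameter subgroup [t ^ c], with the junk value 1 at [t = 0]. *)
Definition cochar (c : 'I_n -> nat) t : borel R n :=
  Borel (diag_borelP (cochar_neq0 c t)).

Lemma cocharE c t : t != 0 -> cochar c t = diag_mx (\row_j t ^+ c j) :> 'M_n.
Proof. by move=> t0; rewrite /= /off0 (negPf t0). Qed.

(* Otherwise unification compares complex numbers by computation. *)
Local Opaque cochar.

Lemma gact_cochar c t M S r j : t != 0 ->
  gact (cochar c t) M S r j = M S r j * t ^+ c j.
Proof.
by move=> t0; rewrite /gact cocharE // tr_diag_mx mul_mx_diag mxE [X in _ * X]mxE.
Qed.

Lemma poly_closed (p : {poly C}) :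
  (forall t, t != 0 -> p.[t] = 0) -> forall t, p.[t] = 0.
Proof.
move=> p0 t; suff -> : p = 0 by rewrite horner0.
by apply: eq_poly_off0 => u u0; rewrite p0 ?horner0.
Qed.

(* [t ^ c M], rebased by the inverse of the pivot columns scaled by powers of
   [t], extends to [t = 0] as a point of the orbit closure. *)
Lemma ev_cochar s M (c : 'I_n -> nat) : clos M ->
  exists f : forall S : finsupp D, 'I_#|fsval S| -> 'I_n,
    (forall S, colsub (f S) (M S) \in unitmx) /\
    exists G : {poly C}, forall t, t != 0 ->
      ev s (gact (cochar c t) M) =
      t ^+ (\sum_S D (fsval S) * \sum_r c (f S r)) * G.[t].
Proof.
move=> cM; have [fM _] := cM.
pose f S := projT1 (cid (pivots c (fM S))).
have fu S : colsub (f S) (M S) \in unitmx.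
  by have [] := projT2 (cid (pivots c (fM S))).
pose B S := colsub (f S) (M S); pose N S := invmx (B S) *m M S.
have fN S r j : N S r j != 0 -> (c (f S r) <= c j)%N.
  by have [_] := projT2 (cid (pivots c (fM S))); apply.
have NB S : colsub (f S) (N S) = 1%:M.
  have -> : colsub (f S) (N S) = invmx (B S) *m B S.
    by apply/matrixP => x y; rewrite !mxE; apply: eq_bigr => z _; rewrite !mxE.
  by rewrite mulVmx //; exact: fu.
exists f; split=> //.
(* By [fN] the subtraction truncates only where the coefficient [N S r j] is 0. *)
pose Mp : poly_frame := fun S =>
  \matrix_(r, j) ((N S r j)%:P * 'X^(c j - c (f S r))).
pose g t S := diag_mx (\row_r t^-1 ^+ c (f S r)) *m invmx (B S).
have MpE t : t != 0 -> at_param Mp t = lact (g t) (gact (cochar c t) M).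
  move=> t0; apply: functional_extensionality_dep => S; apply/matrixP => r j.
  have -> : lact (g t) (gact (cochar c t) M) S r j =
      t^-1 ^+ c (f S r) * N S r j * t ^+ c j.
    rewrite /lact /g -mulmxA mul_diag_mx mxE [X in X * _ = _]mxE -mulrA.
    congr (_ * _); rewrite /N !mxE mulr_suml; apply: eq_bigr => k _.
    by rewrite gact_cochar // mulrA.
  have -> : at_param Mp t S r j = N S r j * t ^+ (c j - c (f S r)).
    by rewrite mxE [Mp S r j]mxE /horner_eval hornerM hornerC hornerXn.
  have [->|/fN h] := eqVneq (N S r j) 0; first by rewrite !(mul0r, mulr0).
  rewrite expfB_cond ?(negPf t0) // exprVn; ring.
have gu t S : t != 0 -> g t S \in unitmx.
  move=> t0; rewrite unitmx_mul unitmx_inv fu andbT unitmxE det_diag unitfE.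
  by apply/prodf_neq0 => i _; rewrite mxE expf_neq0 // invr_eq0.
have cMp0 t : t != 0 -> clos (at_param Mp t).
  move=> t0; rewrite MpE //; apply: clos_lact; first by move=> S; exact: gu.
  exact: orbit_closure_gact.
have cMp t : clos (at_param Mp t).
  (* At t = 0 the pivot columns still form the identity, so the limit is a frame. A polynomial
     vanishing on the orbit vanishes along the curve for t != 0, hence everywhere on it. *)
  split=> [S|p p0].
    apply: (@row_free_mulr _ _ _ _ (colsub (f S) 1%:M)).
    rewrite mulmx_colsub mulmx1.
    suff -> : colsub (f S) (at_param Mp t S) = 1%:M by rewrite unitmx1.
    apply/matrixP => r r'; have /matrixP/(_ r r') := NB S; rewrite !mxE => ->.
    rewrite /horner_eval hornerM hornerC hornerXn; case: eqVneq => [->|_].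
      by rewrite subnn mul1r.
    by rewrite mul0r.
  have [P PE] := peval_param p Mp; rewrite PE; move: t; apply: poly_closed => t t0.
  by rewrite -PE; have [_] := cMp0 t t0; apply.
have [P PE] := ev_param s cMp.
(* The determinant of [g t S] is a negative power of t divided by \det (B S). The power of t becomes
   the announced factor, the determinants of B go into G. *)
exists ((\prod_S \det (B S) ^+ D (fsval S)) *: P) => t t0.
have cT : clos (gact (cochar c t) M) by exact: orbit_closure_gact.
have cgT : clos (lact (g t) (gact (cochar c t) M)) by rewrite -MpE.
rewrite hornerZ -PE MpE // (ev_rebase s cT cgT (fun S => erefl)).
rewrite !mulrA -[LHS]mul1r; congr (_ * _).
rewrite expr_sum -!big_split /= big1 // => S _.
rewrite mulnC exprM -!exprMn det_mulmx det_diag det_inv.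
rewrite (eq_bigr (fun r => (t ^+ c (f S r))^-1)); last by move=> r _; rewrite mxE exprVn.
have dB : \det (B S) != 0 by have := fu S; rewrite unitmxE unitfE.
have tc0 : \prod_r t ^+ c (f S r) != 0.
  by apply/prodf_neq0 => r _; rewrite expf_neq0.
rewrite expr_sum prodfV mulrA -(mulrA _ (\det (B S))) (mulrC (\det _)) mulrA.
by rewrite divff // mul1r divff // expr1n.
Qed.

(** * Torus weights of sections *)

Lemma gact_cocharM c c' t t' M : t != 0 -> t' != 0 ->
  gact (cochar c t) (gact (cochar c' t') M) =
  gact (cochar c' t') (gact (cochar c t) M).
Proof.
move=> t0 t'0; apply: functional_extensionality_dep => S; apply/matrixP => r j.
by rewrite !gact_cochar // mulrAC.
Qed.

(** Rebasing by the scalar t multiplies every section by t to this power. *)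
Definition total_degree := (\sum_(S : finsupp D) D (fsval S) * #|fsval S|)%N.
Local Notation d := total_degree.

Lemma gact_cochar1 (c : 'I_n -> nat) t M : t != 0 -> (forall i, c i <= 1)%N ->
  gact (cochar c t) M =
  lact (fun S => t%:M) (gact (cochar (fun i => 1 - c i)%N t^-1) M).
Proof.
move=> t0 c1; apply: functional_extensionality_dep => S; apply/matrixP => r j.
rewrite gact_cochar // /lact mul_scalar_mx mxE gact_cochar ?invr_eq0 //.
rewrite mulrCA; congr (_ * _).
by case: (c j) (c1 j) => [|[|//]] _; rewrite ?expr1 ?expr0 ?mulr1 ?divff.
Qed.

(** By [gact_cochar1] the value at t is also t ^ d times a polynomial in t^-1, so [size_poly_inv]
    applies. *)
Lemma ev_cochar_size s M (c : 'I_n -> nat) : clos M -> (forall i, c i <= 1)%N ->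
  exists2 G : {poly C}, (size G <= d.+1)%N &
    forall t, t != 0 -> ev s (gact (cochar c t) M) = G.[t].
Proof.
move=> cM c1.
have [f [_ [G GE]]] := ev_cochar s c cM.
have [f' [_ [G' G'E]]] := ev_cochar s (fun i => 1 - c i)%N cM.
set h := (\sum_S _)%N in GE; set h' := (\sum_S _)%N in G'E.
exists ('X^h * G) => [|t t0]; last by rewrite GE // hornerM hornerXn.
apply: (@size_poly_inv _ d _ ('X^h' * G')) => t t0.
rewrite !hornerM !hornerXn -GE // -G'E ?invr_eq0 //.
rewrite gact_cochar1 //.
rewrite (@ev_rebase s (gact (cochar (fun i => 1 - c i)%N t^-1) M) _ (fun S => t%:M)) //.
- congr (_ * _); rewrite expr_sum; apply: eq_bigr => S _.
  by rewrite det_scalar -exprM mulnC.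
- exact: orbit_closure_gact.
apply: clos_lact; last exact: orbit_closure_gact.
by move=> S; rewrite unitmxE det_scalar unitfE expf_neq0.
Qed.

Definition unit_weight (i j : 'I_n) : nat := i == j.
Local Notation e_ := unit_weight.

Lemma unit_weight_le1 i j : (e_ i j <= 1)%N.
Proof. exact: leq_b1. Qed.

(** Only the first m coordinates of the torus are tested, so that the decomposition can go by
    induction on m. The case m = n is a weight vector for the full torus. *)
Definition is_weight (m : nat) (a : 'I_n -> nat) s :=
  forall i : 'I_n, (i < m)%N -> forall t, t != 0 -> forall M, clos M ->
    ev s (gact (cochar (e_ i) t) M) = t ^+ a i * ev s M.

Lemma weight_split i s : exists F : 'I_d.+1 -> section,
  [/\ s = \sum_k F k,
      forall k t M, t != 0 -> clos M ->
        ev (F k) (gact (cochar (e_ i) t) M) = t ^+ k * ev (F k) M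
    & forall m a k, is_weight m a s -> is_weight m a (F k)].
Proof.
have [L LE] := interpolation C d.
pose F k := \sum_m L m k *: pull (cochar (e_ i) m.+1%:R) s.
have s0 (m : 'I_d.+1) : m.+1%:R != 0 :> C by rewrite pnatr_eq0.
have FE k M : clos M -> ev (F k) M =
    \sum_m L m k * ev s (gact (cochar (e_ i) m.+1%:R) M).
  by move=> cM; rewrite ev_sum; apply: eq_bigr => m _; rewrite evZ ev_pull.
have FG M (G : {poly C}) (k : 'I_d.+1) : clos M -> (size G <= d.+1)%N ->
    (forall t, t != 0 -> ev s (gact (cochar (e_ i) t) M) = G.[t]) ->
    ev (F k) M = G`_k.
  move=> cM sG GE; rewrite FE // LE //; apply: eq_bigr => m _.
  by rewrite GE.
have mulcc t t' M : t != 0 -> t' != 0 ->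
    gact (cochar (e_ i) t) (gact (cochar (e_ i) t') M) = gact (cochar (e_ i) (t * t')) M.
  move=> t0 t'0; apply: functional_extensionality_dep => S; apply/matrixP => r j.
  have tt0 : t * t' != 0 by exact: mulf_neq0 t0 t'0.
  rewrite !gact_cochar //.
  by rewrite exprMn -mulrA (mulrC (t' ^+ _)).
exists F; split.
- apply: ev_inj => M cM; rewrite ev_sum.
  have [G sG GE] := ev_cochar_size s cM (unit_weight_le1 i).
  under eq_bigr do rewrite (FG M G) //.
  have -> : ev s M = G.[1].
    rewrite -GE ?oner_neq0 //; congr (ev s _).
    apply: functional_extensionality_dep => S; apply/matrixP => r j.
    by rewrite gact_cochar ?oner_neq0 // expr1n mulr1.
  rewrite (horner_coef_wide _ sG); apply: eq_bigr => k _.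
  by rewrite expr1n mulr1.
- move=> k t M t0 cM.
  have [G sG GE] := ev_cochar_size s cM (unit_weight_le1 i).
  rewrite (FG M G) // (FG _ (\poly_(j < d.+1) (t ^+ j * G`_j))) //; first last.
  + move=> t' t'0; rewrite mulcc // GE ?mulf_neq0 // horner_poly.
    rewrite (horner_coef_wide _ sG); apply: eq_bigr => j _.
    by rewrite exprMn; ring.
  + exact: orbit_closure_gact.
  by rewrite coef_poly ltn_ord.
- move=> m a k ws j jm t t0 M cM; rewrite !FE //; last exact: orbit_closure_gact.
  rewrite mulr_sumr; apply: eq_bigr => l _; rewrite gact_cocharM //.
  rewrite ws //; first by rewrite mulrCA.
  exact: orbit_closure_gact.
Qed.

Lemma weight_decomposition m s : exists2 l : seq section,
  forall x, x \in l -> exists a, is_weight m a x & s = \sum_(x <- l) x.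
Proof.
elim: m s => [|m IH] s.
  by exists [:: s]; rewrite ?big_seq1 // => x _; exists (fun=> 0%N).
have [l lP ->] := IH s.
have {IH} split1 x : x \in l -> exists2 l' : seq section,
    forall y, y \in l' -> exists a, is_weight m.+1 a y & x = \sum_(y <- l') y.
  move=> /lP[a wx]; have [mn|nm] := ltnP m n; last first.
    exists [:: x]; rewrite ?big_seq1 // => y; rewrite inE => /eqP ->.
    by exists a => i im; apply: wx; rewrite (leq_trans (ltn_ord i)).
  have [F [Es Fi Fw]] := weight_split (Ordinal mn) x.
  exists [seq F k | k <- index_enum _]; last by rewrite big_map.
  move=> y /mapP[k _ ->]; exists (fun i : 'I_n => if i == m :> nat then k : nat else a i).
  move=> i; rewrite ltnS leq_eqVlt => im t t0 M cM; case: eqVneq im => [im _|im im'].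
    have -> : i = Ordinal mn by exact: val_inj.
    exact: Fi.
  exact: (Fw m).
elim: l lP split1 => [|x l IH] lP split1; first by exists [::]; rewrite ?big_nil.
have [||l1 l1P e1] := IH.
- by move=> y yl; apply: lP; rewrite inE yl orbT.
- by move=> y yl; apply: split1; rewrite inE yl orbT.
have [l2 l2P e2] := split1 x (mem_head _ _).
exists (l2 ++ l1); last by rewrite big_cons big_cat /= -e1 -e2.
by move=> y; rewrite mem_cat => /orP[/l2P|/l1P].
Qed.

(** * Root subgroups and unitriangular matrices *)

Lemma unitriangular_borelP (A : 'M[C]_n) : (forall i, A i i = 1) ->
  (forall i j : 'I_n, (j < i)%N -> A i j = 0) ->
  (A \in unitmx) && is_trig_mx A^T.
Proof.
move=> A1 A0; have tA : is_trig_mx A^T.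
  by apply/is_trig_mxP => i j ij; rewrite mxE A0.
rewrite tA andbT -unitmx_tr unitmxE det_trig // big1 ?unitr1 // => i _.
by rewrite mxE A1.
Qed.

Section Root.
Variables (i j : 'I_n) (ij : (i < j)%N).

Definition root_mx t : 'M[C]_n := 1%:M + t *: delta_mx i j.

Lemma root_mxE t k l : root_mx t k l = (k == l)%:R + t * ((k == i) && (l == j))%:R.
Proof. by rewrite !mxE. Qed.

Fact root_borelP t : (root_mx t \in unitmx) && is_trig_mx (root_mx t)^T.
Proof.
apply: unitriangular_borelP => [k|k l lk]; rewrite root_mxE.
  rewrite eqxx; case: eqVneq => [->|_] /=; last by rewrite mulr0 addr0.
  by rewrite -val_eqE ltn_eqF // mulr0 addr0.
rewrite -val_eqE gtn_eqF //; case: eqVneq => [ki|_] /=; last by rewrite mulr0 addr0.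
case: eqVneq => [lj|_] /=; last by rewrite mulr0 addr0.
by move: lk; rewrite ki lj ltnNge ltnW.
Qed.

Definition root_elt t : borel R n := Borel (root_borelP t).

Lemma root_conj t M : t != 0 ->
  gact (root_elt t) M =
  gact (cochar (e_ i) t) (gact (root_elt 1) (gact (cochar (e_ i) t^-1) M)).
Proof.
move=> t0; rewrite !gactM; congr gact.
have ti0 : t^-1 != 0 by rewrite invr_eq0.
rewrite !cocharE //; apply/matrixP => k l.
have -> : (diag_mx (\row_m t ^+ e_ i m) *m root_mx 1 *m
    diag_mx (\row_m t^-1 ^+ e_ i m)) k l = t ^+ e_ i k * root_mx 1 k l * t^-1 ^+ e_ i l.
  by rewrite mul_mx_diag mul_diag_mx !mxE.
rewrite !root_mxE mul1r /e_.
rewrite mulrDr mulrDl; congr (_ + _).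
  case: eqVneq => [<-|_]; last by rewrite mulr0 mul0r.
  by rewrite mulr1 -exprMn divff // expr1n.
case: (eqVneq k i) => [_|_]; last by rewrite /= !mulr0 mul0r.
case: (eqVneq l j) => [->|_]; last by rewrite /= !mulr0 mul0r.
by rewrite -val_eqE (ltn_eqF ij) expr1 expr0 !mulr1.
Qed.

(** The curve is defined for all t, so the value is a polynomial. For its degree, split s by weights
    k <= d of coordinate i: by [root_conj] the k-th part contributes t ^ k times a polynomial in
    t^-1. *)
Lemma ev_root s M : clos M -> exists2 P : {poly C}, (size P <= d.+1)%N &
  forall t, ev s (gact (root_elt t) M) = P.[t].
Proof.
move=> cM.
pose Mp : poly_frame := fun S =>
  map_mx polyC (M S) *m (1%:M + 'X *: delta_mx i j : 'M[{poly C}]_n)^T.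
have MpE t : at_param Mp t = gact (root_elt t) M.
  apply: functional_extensionality_dep => S; rewrite /at_param /Mp map_mxM /=.
  congr (_ *m _); first by apply/matrixP => k l; rewrite !mxE /horner_eval hornerC.
  apply/matrixP => k l; rewrite !mxE /horner_eval.
  by rewrite hornerD hornerM hornerX -!polyC_natr !hornerC.
have [t|P PE] := @ev_param s Mp; first by rewrite MpE; exact: orbit_closure_gact.
exists P => [|t]; last by rewrite -MpE.
have [F [Es Fi _]] := weight_split i s.
have /choice[H HP] k : exists G : {poly C}, forall t, t != 0 ->
    ev (pull (root_elt 1) (F k)) (gact (cochar (e_ i) t) M) = G.[t].
  have [G _ GE] := ev_cochar_size (pull (root_elt 1) (F k)) cM (unit_weight_le1 i).
  by exists G.
apply: (@size_poly_inv _ d _ (\sum_(k < d.+1) 'X^(d - k) * H k)) => t t0.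
have ti0 : t^-1 != 0 by rewrite invr_eq0.
have cT : clos (gact (cochar (e_ i) t^-1) M) by exact: orbit_closure_gact.
rewrite -PE MpE root_conj // {1}Es ev_sum horner_sum mulr_sumr.
apply: eq_bigr => k _; rewrite Fi //; last exact: orbit_closure_gact.
rewrite -ev_pull // HP // hornerM hornerXn mulrA; congr (_ * _).
have kd : (k <= d)%N by rewrite -ltnS.
by rewrite exprVn expfB_cond ?(negPf t0) // invf_div mulrCA divff ?mulr1 // expf_neq0.
Qed.
End Root.

(* The entries of [u] above the diagonal are put in place one at a time, in
   row-major order; this factors a unitriangular matrix into root elements. *)
Definition trunc (u : 'M[C]_n) (m : nat) : 'M[C]_n :=
  \matrix_(i, j) if (i < j)%N && (i * n + j < m)%N then u i j else (i == j)%:R.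

Fact trunc_borelP u m : (trunc u m \in unitmx) && is_trig_mx (trunc u m)^T.
Proof.
apply: unitriangular_borelP => [i|i j ji]; rewrite mxE; first by rewrite ltnn eqxx.
by rewrite ltnNge ltnW //= -val_eqE gtn_eqF.
Qed.

Definition trunc_elt u m : borel R n := Borel (trunc_borelP u m).

(** The root matrix adds u i j times row j to row i, and at stage m row j, lying below row i, is
    still a row of the identity. *)
Lemma truncS u m (i j : 'I_n) : (i < j)%N -> (i * n + j)%N = m ->
  trunc u m.+1 = root_mx i j (u i j) *m trunc u m.
Proof.
move=> ij mE; rewrite mulmxDl mul1mx -scalemxAl; apply/matrixP => k l.
rewrite [RHS]mxE [X in _ = _ + X]mxE.
have -> : (delta_mx i j *m trunc u m) k l = ((k == i) && (l == j))%:R.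
  rewrite mxE (bigD1 j) //= big1 => [|x xj]; last first.
    by rewrite mxE (negPf xj) andbF mul0r.
  rewrite !mxE eqxx andbT addr0 -mE; case: eqVneq => [_|]; last by rewrite mul0r.
  have -> : (j * n + l < i * n + j)%N = false.
    apply/negbTE; rewrite -leqNgt; apply: leq_trans (leq_addr _ _).
    apply: leq_trans (leq_mul ij (leqnn n)); rewrite mulSn addnC leq_add2r.
    exact: ltnW.
  by rewrite andbF mul1r eq_sym.
rewrite !mxE [(_ < m.+1)%N]ltnS [(_ <= m)%N]leq_eqVlt.
case: (boolP ((k == i) && (l == j))) => [|kl].
  case/andP=> /eqP -> /eqP ->; rewrite mE eqxx ltnn ij /=.
  by rewrite -val_eqE (ltn_eqF ij) add0r mulr1.
rewrite mulr0 addr0; suff -> : (k * n + l == m)%N = false by [].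
apply: contraNF kl => /eqP; rewrite -mE => e.
have n0 : (0 < n)%N by apply: leq_ltn_trans (ltn_ord i).
have := congr1 (divn^~ n) e; rewrite !divnMDl // !divn_small // !addn0 => ki.
have := congr1 (modn^~ n) e; rewrite !modnMDl !modn_small // => lj.
by apply/andP; split; apply/eqP/val_inj.
Qed.

Lemma truncS_skip u m : (forall i j : 'I_n, (i < j)%N -> (i * n + j)%N != m) ->
  trunc u m.+1 = trunc u m.
Proof.
move=> h; apply/matrixP => i j; rewrite !mxE; case: ltnP => //= ij.
by rewrite ltnS leq_eqVlt (negPf (h i j ij)).
Qed.

(** * Evaluation of sections on a finite grid *)

Definition grid (v : 'M['I_d.+1]_n) : 'M[C]_n := map_mx (fun k : 'I_d.+1 => k%:R) v.

Local Notation z := (z_frame R (D := D)).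

Lemma clos_z (b : borel R n) : clos (gact b z).
Proof. by apply: orbit_clos; exists b => S; exact/eqmxP. Qed.

(** The parameter of the last root element enters through a polynomial of degree at most d, which
    vanishes once it does at 0, ..., d. With that parameter fixed to k, the induction hypothesis
    applies to the section pulled back by the root element. *)
Lemma grid_determines m s :
  (forall v, ev s (gact (trunc_elt (grid v) m) z) = 0) ->
  forall u, ev s (gact (trunc_elt u m) z) = 0.
Proof.
elim: m s => [|m IH] s s0 u.
  rewrite -(s0 (const_mx ord0)) /=.
  suff -> : trunc u 0 = trunc (grid (const_mx ord0)) 0 by [].
  by apply/matrixP => i j; rewrite !mxE ltn0 andbF.
have [[i [j [ij mE]]]|nij] := pselect (exists i j : 'I_n, (i < j)%N /\ (i * n + j)%N = m);
    last first.
  have eT u' : gact (trunc_elt u' m.+1) z = gact (trunc_elt u' m) z.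
    rewrite /= truncS_skip // => i' j' ij'; apply/eqP => e.
    by apply: nij; exists i', j'.
  by rewrite eT; apply: IH => v; rewrite -eT.
have eT u' : gact (trunc_elt u' m.+1) z =
    gact (root_elt ij (u' i j)) (gact (trunc_elt u' m) z).
  by rewrite gactM /= (truncS _ ij mE).
rewrite eT; have [P sP PE] := ev_root ij s (clos_z (trunc_elt u m)).
rewrite PE; suff -> : P = 0 by rewrite horner0.
apply: (@roots_geq_poly_eq0 _ _ [seq k%:R | k <- iota 0 d.+1]).
- apply/allP => _ /mapP[k + ->]; rewrite mem_iota /= add0n => kd.
  rewrite /root -PE -ev_pull; last exact: clos_z.
  apply/eqP; apply: IH => v; rewrite ev_pull; last exact: clos_z.
  (* Stage m does not read the entry (i, j), so it can be set to k without changing [trunc]. *)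
  pose v' := \matrix_(i', j') if (i' == i) && (j' == j) then Ordinal kd else v i' j'.
  rewrite -(s0 v') eT.
  have -> : grid v' i j = k%:R by rewrite !mxE !eqxx.
  congr (ev s (gact (root_mx i j k%:R) _)).
  suff e : trunc (grid v) m = trunc (grid v') m by rewrite /= e.
  apply/matrixP => i' j'; rewrite !mxE; case: ifP => // /andP[_ lt].
  case: (boolP ((i' == i) && (j' == j))) => [/andP[/eqP ei /eqP ej]|//].
  by move: lt; rewrite ei ej mE ltnn.
- by rewrite map_inj_uniq ?iota_uniq // => k l /eqP; rewrite eqr_nat => /eqP.
- by rewrite size_map size_iota.
Qed.

(** Write b = U T with U unitriangular and T diagonal. T only rescales the basis vectors of the
    coordinate subspaces z, so the values at U z decide the vanishing on the orbit. *)
Lemma section_grid s :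
  (forall v, ev s (gact (trunc_elt (grid v) (n * n)) z) = 0) -> s = 0.
Proof.
move=> /grid_determines s0; apply: section_dense => M oM; have [b bM] := oM.
have /andP[ub tb] := borelP b.
have b0 (i j : 'I_n) : (j < i)%N -> borel_mx b i j = 0.
  by move=> ji; have /is_trig_mxP/(_ j i ji) := tb; rewrite mxE.
have bd i : borel_mx b i i != 0.
  move: ub; rewrite -unitmx_tr unitmxE det_trig // unitfE => /prodf_neq0/(_ i isT).
  by rewrite mxE.
pose T : 'rV[C]_n := \row_i borel_mx b i i.
pose U := borel_mx b *m diag_mx (\row_i (borel_mx b i i)^-1).
have UE i j : U i j = borel_mx b i j / borel_mx b j j by rewrite /U mul_mx_diag !mxE.
have U' : U = trunc U (n * n).
  apply/matrixP => i j; rewrite [RHS]mxE.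
  have -> : (i * n + j < n * n)%N.
    apply: (@leq_trans (i.+1 * n)); last by rewrite leq_mul2r ltn_ord orbT.
    by rewrite mulSn addnC ltn_add2r.
  rewrite andbT; case: ltngtP => [//|ji|ij].
    by rewrite UE b0 // mul0r -val_eqE gtn_eqF.
  by rewrite (val_inj ij) UE divff // eqxx.
have bE : borel_mx b = trunc_elt U (n * n) *m diag_mx T :> 'M_n.
  rewrite /= -U'; apply/matrixP => i j; rewrite mul_mx_diag mxE UE mxE.
  by rewrite divfK.
pose g (S : finsupp D) := diag_mx (\row_r T 0 (enum_val r)) : 'M[C]_#|fsval S|.
have bz S : gact b z S = g S *m gact (trunc_elt U (n * n)) z S.
  rewrite bE -gactM /gact mulmxA; congr (_ *m _); rewrite tr_diag_mx.
  rewrite mul_mx_diag mul_diag_mx; apply/matrixP => r j; rewrite !mxE.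
  by case: eqVneq => [->|_]; rewrite ?mulr1 ?mul1r // !(mul0r, mulr0).
have /choice_dep[h hE] : forall S : finsupp D,
    exists h : 'M[C]_#|fsval S|, M S = h *m gact b z S.
  by move=> S; have /andP[/submxP] := bM S.
rewrite (@ev_rebase s (gact b z) M h) //; [|exact: clos_z|exact: orbit_clos].
rewrite (@ev_rebase s (gact (trunc_elt U (n * n)) z) _ g) //;
  [|exact: clos_z|exact: clos_z].
by rewrite s0 !mulr0.
Qed.

Definition grid_ev s : 'rV[C]_#|{: 'M['I_d.+1]_n}| :=
  \row_k ev s (gact (trunc_elt (grid (enum_val k)) (n * n)) z).

Fact grid_ev_linear : linear grid_ev.
Proof. by move=> a s s'; apply/rowP => k; rewrite !mxE evD evZ. Qed.

HB.instance Definition _ := GRing.isLinear.Build C section _ _ grid_ev grid_ev_linear.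

Lemma grid_ev_inj : injective grid_ev.
Proof.
move=> s s' e; apply/eqP; rewrite -subr_eq0; apply/eqP; apply: section_grid => v.
have /rowP/(_ (enum_rank v)) : grid_ev (s - s') = 0 by rewrite linearB /= e subrr.
by rewrite !mxE enum_rankK.
Qed.

Lemma weight_basis : exists m (e : 'I_m -> section) (a : 'I_m -> 'X_{1..n}),
  (forall j, is_weight n (a j) (e j)) /\
  forall s, exists! x : 'rV[C]_m, s = \sum_j x 0 j *: e j.
Proof.
have [N [e [we be]]] := basis_of_span grid_ev_inj (weight_decomposition n).
have /choice[a aw] j : exists a : 'X_{1..n}, is_weight n a (e j).
  have [a wa] := we j; exists [multinom a i | i < n] => i.
  by rewrite mnmE; exact: wa.
by exists N, e, a.
Qed.

Lemma ev_diag s a (b : borel R n) (x : 'rV[C]_n) M : clos M ->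
  is_weight n a s -> borel_mx b = diag_mx x ->
  ev s (gact b M) = (\prod_i x 0 i ^+ a i) * ev s M.
Proof.
move=> cM sa bx.
have x0 i : x 0 i != 0.
  have /andP[] := borelP b; rewrite bx unitmxE det_diag unitfE.
  by move=> /prodf_neq0/(_ i isT).
(* The diagonal matrix is filled in one coordinate at a time, each step being a one-parameter
   subgroup. *)
pose y m : 'rV[C]_n := \row_j if (j < m)%N then x 0 j else 1.
have y0 m i : y m 0 i != 0 by rewrite mxE; case: ifP => // _; exact: oner_neq0.
have -> : borel_mx b = Borel (diag_borelP (y0 n)).
  by rewrite bx /=; congr diag_mx; apply/rowP => j; rewrite mxE ltn_ord.
have -> : \prod_i x 0 i ^+ a i = \prod_(i < n | (i < n)%N) x 0 i ^+ a i.
  by apply: eq_bigl => i; rewrite ltn_ord.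
suff main m : (m <= n)%N -> ev s (gact (Borel (diag_borelP (y0 m))) M) =
    \prod_(i < n | (i < m)%N) x 0 i ^+ a i * ev s M by exact: main.
elim: m => [_|m IH mn].
  rewrite big_pred0 // mul1r; congr (ev s _).
  apply: functional_extensionality_dep => S; rewrite /gact tr_diag_mx.
  suff -> : diag_mx (y 0%N) = 1%:M by rewrite mulmx1.
  by rewrite -diag_const_mx; congr diag_mx; apply/rowP => j; rewrite !mxE.
pose i := Ordinal mn; rewrite (bigD1 i) //=.
rewrite (eq_bigl (fun k : 'I_n => k < m)%N); last first.
  by move=> k; rewrite -val_eqE /= ltnS ltn_neqAle andbC.
rewrite -mulrA -(IH (ltnW mn)) -(sa i (ltn_ord i) _ (x0 i)); last first.
  exact: (orbit_closure_gact (Borel (diag_borelP (y0 m)))).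
congr (ev s _); apply: functional_extensionality_dep => S; apply/matrixP => r j.
rewrite gact_cochar // /gact !tr_diag_mx !mul_mx_diag !mxE -mulrA.
congr (_ * _); rewrite /e_ ltnS leq_eqVlt -val_eqE /=.
case: eqVneq => [e|_]; last by rewrite mulr1.
by rewrite e ltnn mul1r expr1; congr (x 0 _); exact: val_inj.
Qed.

End Geometry.

(** * The support of the character *)

Section Character.
Variables (R : realType) (n : nat) (D : {mset {set 'I_n}}).
Local Notation C := R[i].
Local Notation frame := (frame R D).
Local Notation clos := (@orbit_closure R n D).
Local Notation orbit := (@Defs.orbit R n D).
Local Notation section := (sections R D).
Local Notation z := (z_frame R (D := D)).
Implicit Types (M N : frame) (s : section) (t : C).

Fact weyl_act_linear (b : borel R n) : linear (@weyl_act R n D b).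
Proof. by move=> a phi psi; apply: val_inj; apply/funext. Qed.

HB.instance Definition _ b := GRing.isLinear.Build C (dual section) (dual section) _
  (@weyl_act R n D b) (weyl_act_linear b).

Lemma pull_comb (b : borel R n) m (x : 'I_m -> C) (e : 'I_m -> section) :
  pull b (\sum_j x j *: e j) = \sum_j x j *: pull b (e j).
Proof.
apply: ev_inj => M cM; rewrite ev_pull // !ev_sum; apply: eq_bigr => j _.
by rewrite !evZ ev_pull.
Qed.

Lemma dual_comb m (x : 'I_m -> C) (phi : 'I_m -> dual section) s :
  (\sum_j x j *: phi j) s = \sum_j x j * phi j s.
Proof.
by elim/big_rec2: _ => [//|j y1 y2 _ <-].
Qed.

Lemma functional_comb m (x : 'I_m -> C) (phi : dual section) (e : 'I_m -> section) :
  phi (\sum_j x j *: e j) = \sum_j x j * phi (e j).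
Proof.
have /asboolP lphi := dual_funP phi.
elim/big_rec2: _ => [|j y1 y2 _ <-]; last by rewrite lphi.
by have := lphi (-1) 0 0; rewrite scaler0 addr0 scaleN1r addNr.
Qed.

Section Basis.
Variables (m : nat) (e : 'I_m -> section) (a : 'I_m -> 'X_{1..n}).
Hypothesis ea : forall j, is_weight n (a j) (e j).
Hypothesis eb : forall s, exists! x : 'rV[C]_m, s = \sum_j x 0 j *: e j.

(** The coordinate functionals of the basis e form a basis of the dual in which the torus is
    diagonal. *)
Lemma weyl_trace (b : borel R n) (x : 'rV[C]_n) : borel_mx b = diag_mx x ->
  is_trace (@weyl_act R n D b) (\sum_j \prod_i x 0 i ^+ a j i).
Proof.
move=> bx; have /choice[co coP] s : exists y : 'rV[C]_m, s = \sum_j y 0 j *: e j.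
  by have [y [yE _]] := eb s; exists y.
have coE s (y : 'rV[C]_m) : s = \sum_j y 0 j *: e j -> co s = y.
  move=> sy; have [y' [_ y'u]] := eb s.
  by rewrite -(y'u _ (coP s)) -(y'u _ sy).
have co_functional j : (fun s => co s 0 j : C^o) \in @is_functional _ section.
  apply/asboolP => c s s' /=.
  rewrite (coE (c *: s + s') (c *: co s + co s')) ?mxE // {1}(coP s) {1}(coP s').
  rewrite scaler_sumr -big_split; apply: eq_bigr => k _ /=.
  by rewrite !mxE scalerDl scalerA.
pose w j := \prod_i x 0 i ^+ a j i.
have coe j : co (e j) = delta_mx 0 j.
  apply: coE; rewrite (bigD1 j) //= big1 => [|k kj].
    by rewrite mxE !eqxx scale1r addr0.
  by rewrite mxE (negPf kj) andbF scale0r.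
have pulle j : pull b (e j) = w j *: e j.
  apply: ev_inj => M cM; rewrite ev_pull // evZ.
  exact: ev_diag.
have cop s j : co (pull b s) 0 j = w j * co s 0 j.
  rewrite (coE _ (\row_k (co s 0 k * w k))) ?mxE 1?mulrC //.
  rewrite {1}(coP s) pull_comb; apply: eq_bigr => k _.
  by rewrite mxE pulle scalerA.
exists m, (fun j => Dual (co_functional j)), (diag_mx (\row_j w j)); split.
- move=> phi; exists (\row_j phi (e j)); split.
    apply: val_inj; apply/funext => s /=.
    rewrite {1}(coP s) functional_comb dual_comb; apply: eq_bigr => j _ /=.
    by rewrite mxE mulrC.
  move=> y ->; apply/rowP => j; rewrite mxE dual_comb (bigD1 j) //= big1.
    by rewrite coe mxE !eqxx mulr1 addr0.
  by move=> k kj; rewrite coe mxE (negPf kj) andbF mulr0.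
- move=> j; apply: val_inj; apply/funext => s /=.
  rewrite cop dual_comb (bigD1 j) //= big1 => [|k kj]; last first.
    by rewrite !mxE (negPf kj) mulr0n mul0r.
  by rewrite !mxE eqxx mulr1n addr0.
- by rewrite mxtrace_diag; apply: eq_bigr => j _; rewrite mxE.
Qed.

(** By [weyl_trace] a character exists, so [xget] does not return its default. By uniqueness of
    traces two characters agree wherever all coordinates are nonzero, hence as polynomials. *)
Lemma characterE : character R D = \sum_j 'X_[a j].
Proof.
have E (x : 'I_n -> C) : mmap intr x (\sum_j 'X_[a j]) = \sum_j \prod_i x i ^+ a j i.
  by rewrite raddf_sum; apply: eq_bigr => j _; rewrite /= mmapX.
have isc : is_character R D (\sum_j 'X_[a j]).
  by move=> b x bx; rewrite E; exact: weyl_trace.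
have chiP : is_character R D (character R D) by exact: (xgetI _ isc).
suff /mpolyP h : map_mpoly intr (character R D - \sum_j 'X_[a j]) = 0 :> {mpoly C[n]}.
  apply/eqP; rewrite -subr_eq0; apply/eqP/mpolyP => q.
  have := h q; rewrite mcoeff_map_mpoly !mcoeff0 => /eqP.
  by rewrite intr_eq0 => /eqP.
apply: mpoly_off0 => x x0; have y0 i : (\row_j x j) 0 i != 0 by rewrite mxE.
have ex : (\row_j x j) 0 = x :> ('I_n -> C) by apply/funext => i; rewrite mxE.
have := chiP (Borel (diag_borelP y0)) _ erefl.
move=> /is_trace_uniq/(_ (weyl_trace (b := Borel (diag_borelP y0)) erefl)).
under eq_bigr do under eq_bigr do rewrite mxE.
rewrite ex => chix.
have -> : (map_mpoly intr (character R D - \sum_j 'X_[a j])).@[x] =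
    mmap intr x (character R D - \sum_j 'X_[a j]).
  rewrite /map_mpoly /mmap raddf_sum; apply: eq_bigr => p _.
  rewrite /= mevalM mevalC /mmap1 rmorph_prod; congr (_ * _).
  by apply: eq_bigr => i _; rewrite rmorphXn /= mevalXU.
by rewrite raddfB /= chix E subrr.
Qed.

(** Expand s in the basis and move M by the torus. This is an identity between polynomials in the
    torus coordinates, whose coefficient at q forces s = 0 unless q is some [a j]. The coefficient
    of the character counts such j, so nothing cancels. *)
Lemma weight_in_character s (q : 'X_{1..n}) : s <> 0 -> is_weight n q s ->
  (character R D)@_q != 0.
Proof.
move=> s0 sq; rewrite characterE raddf_sum /=.
have [j aj] : exists j, a j = q.
  apply: contrapT => na; apply: s0; apply: ev_inj => M cM; rewrite ev0.
  have [x [sx _]] := eb s.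
  suff /mpolyP/(_ q) : ev s M *: 'X_[q] - \sum_j (x 0 j * ev (e j) M) *: 'X_[a j] = 0.
    rewrite mcoeffB mcoeffZ mcoeffX eqxx mulr1 raddf_sum /= big1 ?subr0 ?mcoeff0 //.
    move=> j _; rewrite mcoeffZ mcoeffX; case: eqP => [aj|_]; last by rewrite mulr0.
    by case: na; exists j.
  apply: mpoly_off0 => y y0; pose Y : 'rV[C]_n := \row_j y j.
  have Y0 i : Y 0 i != 0 by rewrite mxE.
  have prodY (p : 'X_{1..n}) : \prod_i Y 0 i ^+ p i = 'X_[p].@[y].
    by rewrite mevalX; apply: eq_bigr => i _; rewrite mxE.
  have evY s' (p : 'X_{1..n}) : is_weight n p s' ->
      ev s' (gact (Borel (diag_borelP Y0)) M) = 'X_[p].@[y] * ev s' M.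
    move=> wp; rewrite (@ev_diag _ _ _ s' p (Borel (diag_borelP Y0)) Y M cM wp erefl).
    by rewrite prodY.
  rewrite mevalB mevalZ (raddf_sum (meval y)) mulrC -evY // {1}sx ev_sum.
  apply/eqP; rewrite subr_eq0; apply/eqP; apply: eq_bigr => j _.
  by rewrite evZ (evY _ _ (ea j)) /= mevalZ mulrCA mulrC.
rewrite (eq_bigr (fun j => (a j == q)%:Z)) => [|k _]; last first.
  by rewrite mcoeffX; case: eqP.
rewrite -(big_morph _ PoszD (erefl 0%:Z)) (bigD1 j) //= aj eqxx.
by [].
Qed.

Lemma character_weight (q : 'X_{1..n}) : (character R D)@_q != 0 ->
  exists2 s : section, s <> 0 & is_weight n q s.
Proof.
rewrite characterE raddf_sum /= => h.
have [j aj] : exists j, a j = q.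
  apply: contrapT => na; move/eqP: h; apply; rewrite big1 // => j _.
  by rewrite mcoeffX; case: eqP => // aj; case: na; exists j.
exists (e j); last by rewrite -aj.
move=> ej0; have [x [_ xu]] := eb 0.
have := xu (delta_mx 0 j); rewrite (xu 0); last first.
  by rewrite big1 // => k _; rewrite mxE scale0r.
move=> /(_ _)/rowP/(_ j); rewrite !mxE !eqxx => h'.
suff /h'/eqP : 0 = \sum_j0 (delta_mx 0 j : 'rV[C]_m) 0 j0 *: e j0.
  by rewrite eq_sym oner_eq0.
rewrite (bigD1 j) //= ej0 scaler0 add0r big1 // => k kj.
by rewrite mxE (negPf kj) andbF scale0r.
Qed.
End Basis.

(** * Bounds on the support of the character *)

Lemma nonzero_at_z s : s <> 0 -> exists b : borel R n, ev s (gact b z) != 0.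
Proof.
move=> s0; apply: contrapT => nb; apply: s0; apply: section_dense => M oM.
have [b bM] := oM.
have /choice_dep[h hE] : forall S : finsupp D,
    exists h : 'M[C]_#|fsval S|, M S = h *m gact b z S.
  by move=> S; have /andP[/submxP] := bM S.
rewrite (@ev_rebase _ _ _ s (gact b z) M h) //; [|exact: clos_z|exact: orbit_clos].
have -> : ev s (gact b z) = 0; last by rewrite mulr0.
by apply/eqP; apply: contrapT => /negP sb; apply: nb; exists b.
Qed.

Lemma character_degree (q : 'X_{1..n}) : (character R D)@_q != 0 ->
  mdeg q = total_degree D.
Proof.
have [m [e [a [ea eb]]]] := weight_basis R D.
move=> /(character_weight ea eb)[s /nonzero_at_z[b sb] sq].
(* The scalar 2 acts on frames both as a torus element and as a rebasing, and its powers are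
   distinct. *)
pose x : 'rV[C]_n := const_mx 2%:R.
have x0 i : x 0 i != 0 by rewrite mxE pnatr_eq0.
have := @ev_diag _ _ _ s q (Borel (diag_borelP x0)) x _ (clos_z D b) sq erefl.
rewrite (@ev_rebase _ _ _ s (gact b z) _ (fun=> 2%:R%:M)); first last.
- by move=> S; rewrite /gact tr_diag_mx diag_const_mx mul_mx_scalar mul_scalar_mx.
- exact/orbit_closure_gact/clos_z.
- exact: clos_z.
move=> /(mulIf sb); under eq_bigr do rewrite det_scalar -exprM mulnC.
under [RHS]eq_bigr do rewrite mxE.
rewrite -!expr_sum -mdegE => /eqP.
by rewrite -!natrX eqr_nat eqn_exp2l // => /eqP.
Qed.

(** The images of these maps are the bases of the Schubert matroid of S. *)
Definition below (S : {set 'I_n}) (f : 'I_#|S| -> 'I_n) :=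
  injective f /\ forall r, (f r <= enum_val r)%N.

(** A nonzero minor has a nonzero term in its Leibniz expansion. The entry of b z in row r and
    column j is b j (enum_val r), which is 0 for j > enum_val r. *)
Lemma below_of_minor (S : finsupp D) (b : borel R n) (f : 'I_#|fsval S| -> 'I_n) :
  colsub f (gact b z S) \in unitmx ->
  exists p : 'S_#|fsval S|, below (fun r => f (p r)).
Proof.
move=> fu; have finj : injective f.
  move=> r r' rr'; apply: contrapT => /eqP ne.
  suff : \det (colsub f (gact b z S))^T = 0.
    by rewrite det_tr => d0; move: fu; rewrite unitmxE d0 unitr0.
  by apply: (determinant_alternate ne) => k; rewrite !mxE rr'.
have [p pP] : exists p : 'S_#|fsval S|, \prod_r colsub f (gact b z S) r (p r) != 0.
  apply: contrapT => np; move: fu; rewrite unitmxE unitfE /determinant big1 ?eqxx //.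
  move=> p _; have -> : \prod_i colsub f (gact b z S) i (p i) = 0.
    by apply/eqP; apply: contrapT => /negP h; apply: np; exists p.
  by rewrite mulr0.
exists p; split=> [r r' /finj/perm_inj //|r].
move/prodf_neq0: pP => /(_ r isT); rewrite leqNgt; apply: contraNN => lt.
rewrite !mxE (bigD1 (enum_val r)) //= big1 => [|j jr]; last first.
  by rewrite mxE (negPf jr) mul0r.
have /andP[_ /is_trig_mxP/(_ _ _ lt)] := borelP b.
by rewrite mxE => ->; rewrite mulr0 addr0.
Qed.

Lemma character_upper (q : 'X_{1..n}) (c : 'I_n -> nat) : (character R D)@_q != 0 ->
  exists f : forall S : finsupp D, 'I_#|fsval S| -> 'I_n, (forall S, below (f S)) /\
    (\sum_S D (fsval S) * \sum_r c (f S r) <= \sum_i c i * q i)%N.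
Proof.
have [m [e [a [ea eb]]]] := weight_basis R D.
move=> /(character_weight ea eb)[s /nonzero_at_z[b sb] sq].
have cb := clos_z D b.
have [f [fu [G GE]]] := ev_cochar s c cb.
have /choice_dep[p pP] : forall S : finsupp D,
    exists p : 'S_#|fsval S|, below (fun r => f S (p r)).
  by move=> S; apply: below_of_minor; exact: fu.
exists (fun S r => f S (p S r)); split=> //.
have -> : (\sum_S D (fsval S) * \sum_r c (f S (p S r)) =
           \sum_S D (fsval S) * \sum_r c (f S r))%N.
  apply: eq_bigr => S _; congr (_ * _)%N.
  by rewrite [RHS](reindex_inj (@perm_inj _ (p S))).
set h := (\sum_S _)%N in GE *; set w := (\sum_i _)%N.
(* Along t ^ c a weight vector is a monomial of exponent w, while [ev_cochar] makes it divisible by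
   'X^h. *)
have E : 'X^h * G = ev s (gact b z) *: 'X^w.
  apply: eq_poly_off0 => t t0.
  rewrite hornerM hornerXn -GE // hornerZ hornerXn.
  rewrite (@ev_diag _ _ _ s q (cochar c t) _ _ cb sq (cocharE _ t0)) mulrC.
  congr (_ * _); rewrite expr_sum; apply: eq_bigr => i _.
  by rewrite mxE exprM.
rewrite leqNgt; apply: contra_notN (negP sb) => lt.
have := congr1 (fun P : {poly C} => P`_w) E.
by rewrite coefXnM lt coefZ coefXn eqxx mulr1 => <-.
Qed.

Definition polynomial_on_lines (F : 'M[C]_n -> C) :=
  forall A B, exists P : {poly C}, forall t, F (A + t *: B) = P.[t].

(** Triangular matrices form a linear space, so lines stay inside it. Invertibility is imposed later
    through the extra factor \det A. *)
Definition somewhere_nonzero (F : 'M[C]_n -> C) :=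
  polynomial_on_lines F /\ exists2 A, is_trig_mx A^T & F A != 0.

Lemma det_on_lines k (L : 'M[C]_n -> 'M[C]_k) :
  (forall A B t, L (A + t *: B) = L A + t *: L B) ->
  polynomial_on_lines (fun A => \det (L A)).
Proof.
move=> Ll A B; exists (\det (map_mx polyC (L A) + 'X *: map_mx polyC (L B))) => t.
rewrite Ll -[X in _ = X]/(horner_eval t _) -det_map_mx; congr (\det _).
by apply/matrixP => i j; rewrite !mxE /= /horner_eval hornerD hornerM hornerX !hornerC.
Qed.

(* On the line through a nonzero of [F] and a nonzero of [G] both functions are
   nonzero polynomials. *)
Lemma somewhere_nonzeroM F G : somewhere_nonzero F -> somewhere_nonzero G ->
  somewhere_nonzero (fun A => F A * G A).
Proof.
move=> [pF [A tA FA]] [pG [B tB GB]]; split.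
  move=> X Y; have [P PE] := pF X Y; have [Q QE] := pG X Y.
  by exists (P * Q) => t; rewrite hornerM PE QE.
have [P PE] := pF A (B - A); have [Q QE] := pG A (B - A).
have P0 : P != 0.
  by apply: contraNneq FA => P0; have := PE 0; rewrite scale0r addr0 P0 horner0 => ->.
have Q0 : Q != 0.
  apply: contraNneq GB => Q0; have := QE 1.
  by rewrite scale1r addrC subrK Q0 horner0 => ->.
have [t _ h] := exists_nonroot (mulf_neq0 P0 Q0).
exists (A + t *: (B - A)); last by rewrite PE QE -hornerM.
apply/is_trig_mxP => i j ij; have /is_trig_mxP/(_ i j ij) := tA.
have /is_trig_mxP/(_ i j ij) := tB; rewrite !mxE => -> ->.
by rewrite oppr0 addr0 mulr0 addr0.
Qed.

Lemma somewhere_nonzero_prod (I : Type) (l : seq I) (F : I -> 'M[C]_n -> C) :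
  (forall i, somewhere_nonzero (F i)) ->
  somewhere_nonzero (fun A => \prod_(i <- l) F i A).
Proof.
move=> FP; elim: l => [|i l IH].
  have -> : (fun A => \prod_(i <- [::]) F i A) = fun=> 1.
    by apply/funext => A; rewrite big_nil.
  split; first by move=> A B; exists 1 => t; rewrite hornerC.
  by exists 0; rewrite ?oner_neq0 // trmx0; apply/is_trig_mxP => i j _; rewrite mxE.
have -> : (fun A => \prod_(k <- i :: l) F k A) =
    fun A => F i A * \prod_(k <- l) F k A.
  by apply/funext => A; rewrite big_cons.
exact: somewhere_nonzeroM.
Qed.

Lemma minor_somewhere_nonzero (S : finsupp D) (f : 'I_#|fsval S| -> 'I_n) : below f ->
  somewhere_nonzero (fun A => \det (colsub f (z S *m A^T))).
Proof.
move=> [finj fle]; split.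
  apply: det_on_lines => A B t; apply/matrixP => r r'; rewrite !mxE.
  rewrite mulr_sumr -big_split; apply: eq_bigr => j _ /=; rewrite !mxE; ring.
(* This matrix sends the basis vector of the r-th element of S to that of [f r]; [below] makes it
   upper triangular. *)
exists (\matrix_(i, j) [exists r, (f r == i) && (enum_val r == j)]%:R).
  apply/is_trig_mxP => i j ij; rewrite !mxE; case: existsP => // -[r].
  by case/andP=> /eqP fr /eqP er; have := fle r; rewrite fr er leqNgt ij.
suff -> : colsub f (z S *m (\matrix_(i, j)
    [exists r, (f r == i) && (enum_val r == j)]%:R)^T) = 1%:M.
  by rewrite det1 oner_neq0.
apply/matrixP => r r'; rewrite !mxE (bigD1 (enum_val r)) //= big1 => [|j jr].
  rewrite !mxE eqxx mul1r addr0; congr (_%:R); congr nat_of_bool.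
  apply/existsP/eqP => [[x /andP[/eqP/finj <- /eqP/enum_val_inj]] //|->].
  by exists r'; rewrite !eqxx.
by rewrite mxE (negPf jr) mul0r.
Qed.

Definition copies : finType := {S : finsupp D & 'I_(D (fsval S))}.

Lemma character_lower (phi : forall k : copies, 'I_#|fsval (tag k)| -> 'I_n) :
  (forall k, below (phi k)) ->
  (character R D)@_[multinom \sum_k \sum_r (phi k r == i : nat) | i < n] != 0.
Proof.
move=> phiP; set q := [multinom _ | i < n].
have [m [e [a [ea eb]]]] := weight_basis R D.
pose p : frame_poly R D := \prod_k \det (\matrix_(r, r') entry_var R r (phi k r')).
have pE M : peval p M = \prod_k \det (colsub (phi k) (M (tag k))).
  rewrite /peval rmorph_prod; apply: eq_bigr => k _.
  rewrite /= -det_map_mx; congr (\det _); apply/matrixP => r r'.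
  by rewrite [LHS]mxE [in LHS]mxE [RHS]mxE; exact: peval_var.
have [s sE] : exists s, forall M, clos M -> ev s M = peval p M.
  apply: section_of_poly => M N g gMN; rewrite !pE.
  have -> : \prod_S \det (g S) ^+ D (fsval S) = \prod_(k : copies) \det (g (tag k)).
    transitivity (\prod_S \prod_(j < D (fsval S)) \det (g S)).
      by apply: eq_bigr => S _; rewrite prodr_const card_ord.
    by rewrite sig_big_dep.
  rewrite -big_split; apply: eq_bigr => k _ /=.
  rewrite -det_mulmx; congr (\det _); rewrite gMN.
  by apply/matrixP => r r'; rewrite !mxE; apply: eq_bigr => x _; rewrite mxE.
apply: (weight_in_character ea eb (s := s)) => [s0|i _ t t0 M cM]; last first.
  rewrite !sE //; last exact: orbit_closure_gact.
  rewrite !pE mnmE expr_sum -big_split; apply: eq_bigr => k _ /=.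
  have -> : colsub (phi k) (gact (cochar (unit_weight i) t) M (tag k)) =
      colsub (phi k) (M (tag k)) *m diag_mx (\row_r t ^+ (phi k r == i)).
    apply/matrixP => r r'; rewrite mul_mx_diag [LHS]mxE gact_cochar // !mxE.
    by rewrite /unit_weight eq_sym.
  rewrite det_mulmx det_diag mulrC expr_sum; congr (_ * _).
  by apply: eq_bigr => r _; rewrite mxE.
(* A point where this product is nonzero lies in the Borel subgroup, and the section is nonzero on
   its translate of z. *)
have [_ [A tA]] : somewhere_nonzero (fun A => \det A *
    \prod_k \det (colsub (phi k) (z (tag k) *m A^T))).
  apply: somewhere_nonzeroM.
    split; first exact: det_on_lines.
    exists 1%:M; last by rewrite det1 oner_neq0.
    by rewrite trmx1 scalar_mx_is_trig.
  by apply: somewhere_nonzero_prod => k; exact: minor_somewhere_nonzero.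
rewrite mulf_eq0 negb_or => /andP[dA /negP]; apply.
have bA : (A \in unitmx) && is_trig_mx A^T by rewrite unitmxE unitfE dA.
have := sE _ (clos_z D (Borel bA)); rewrite s0 ev0 pE => /esym/eqP.
by [].
Qed.

End Character.

(** * Schubert matroids *)

Section Bruhat.
Variable n : nat.
Implicit Types (A I J S T X : {set 'I_n}).

Definition prefix A (j : nat) := #|[set x in A | (x < j)%N]|.

(* [I] is obtained from [S] by decreasing elements. *)
Definition set_le I S := #|I| = #|S| /\ forall j, (prefix S j <= prefix I j)%N.

Lemma prefix_le A j k : (j <= k)%N -> (prefix A j <= prefix A k)%N.
Proof.
move=> jk; apply: subset_leq_card; apply/subsetP => x; rewrite !inE.
by case/andP=> -> /leq_trans ->.
Qed.

Lemma prefix_card A j : (prefix A j <= #|A|)%N.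
Proof. by apply: subset_leq_card; apply/subsetP => x; rewrite inE => /andP[]. Qed.

Lemma prefix_full A j : (n <= j)%N -> prefix A j = #|A|.
Proof.
move=> nj; apply: eq_card => x; rewrite inE.
by rewrite (leq_trans (ltn_ord x) nj) andbT.
Qed.

Lemma prefixD1 A x j : x \in A -> prefix A j = ((x < j) + prefix (A :\ x) j)%N.
Proof.
move=> xA; rewrite /prefix (cardsD1 x) inE xA /=; congr (_ + _)%N.
by apply: eq_card => y; rewrite !inE andbA.
Qed.

Lemma prefixU1 A x j : x \notin A -> prefix (x |: A) j = ((x < j) + prefix A j)%N.
Proof. by move=> xA; rewrite (@prefixD1 _ x) ?setU11 // setU1K. Qed.

Lemma prefixS A (x : 'I_n) : prefix A x.+1 = (prefix A x + (x \in A))%N.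
Proof.
case: (boolP (x \in A)) => xA; last first.
  rewrite addn0; apply: eq_card => y; rewrite !inE ltnS leq_eqVlt.
  case: (boolP (y \in A)) => //= yA; case: eqP => //= /val_inj yx.
  by rewrite -yx yA in xA.
rewrite !(prefixD1 _ xA) ltnn ltnSn addn1 add0n add1n; congr _.+1.
apply: eq_card => y; rewrite !inE ltnS leq_eqVlt.
by case: eqP => //= /eqP yx; case: eqP => //= /val_inj/eqP; rewrite (negPf yx).
Qed.

Lemma prefix0 A : prefix A 0 = 0%N.
Proof. by apply: eq_card0 => x; rewrite inE ltn0 andbF. Qed.

Lemma prefixC A j : (j <= n)%N -> (prefix A j + prefix (~: A) j)%N = j.
Proof.
elim: j => [|j IH] jn; first by rewrite !prefix0.
rewrite !(prefixS _ (Ordinal jn)) /= inE addnACA IH ?(ltnW jn) //.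
by case: (_ \in A); rewrite addn1.
Qed.

(** Match the largest element of I with the largest element of S and remove both. *)
Lemma set_le_matching I S : set_le I S -> exists g : 'I_n -> 'I_n,
  [/\ {in S &, injective g}, g @: S = I & forall x, x \in S -> (g x <= x)%N].
Proof.
move: {2}#|S| (erefl #|S|) => k; elim: k I S => [|k IH] I S Sk [IS le].
  exists id; move/eqP: Sk; rewrite cards_eq0 => /eqP S0; rewrite S0 imset0.
  split=> //; apply/esym/eqP; rewrite -cards_eq0 IS S0.
  by rewrite cards0.
have [s0 s0S] : exists x, x \in S by apply/set0Pn; rewrite -card_gt0 Sk.
have [i0 i0I] : exists x, x \in I by apply/set0Pn; rewrite -card_gt0 IS Sk.
have [M Mmem Mmax] := arg_maxnP (fun x : 'I_n => x : nat) s0S.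
have [m mmem mmax] := arg_maxnP (fun x : 'I_n => x : nat) i0I.
have MS : M \in S := Mmem; have mI : m \in I := mmem.
have mM : (m <= M)%N.
  have := le M.+1; have -> : prefix S M.+1 = #|S|.
    by apply: eq_card => x; rewrite inE ltnS; case: (boolP (x \in S)) => // /Mmax.
  rewrite -IS => h; have : I \subset [set x in I | (x < M.+1)%N].
    rewrite -(geq_leqif (subset_leqif_card _)) //; apply/subsetP => x.
    by rewrite inE => /andP[].
  by move/subsetP/(_ m mI); rewrite inE ltnS => /andP[].
have cS : #|S :\ M| = k by have := cardsD1 M S; rewrite MS Sk add1n => -[].
have cI : #|I :\ m| = k by have := cardsD1 m I; rewrite mI IS Sk add1n => -[].
have [||g [ginj gI gle]] := IH (I :\ m) (S :\ M); first exact: cS.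
- split; first by rewrite cI cS.
  move=> j; have := le j; rewrite (prefixD1 _ MS) (prefixD1 _ mI).
  have [jm|mj] := leqP j m.
    by rewrite add0n; apply: leq_trans; exact: leq_addl.
  move=> _; apply: leq_trans (prefix_card _ _) _.
  have -> : prefix (I :\ m) j = #|I :\ m|.
    apply: eq_card => x; rewrite !inE; case: (boolP (x \in I)) => xI; rewrite ?andbF //.
    by rewrite andbT (leq_ltn_trans (mmax _ xI) mj) andbT.
  by rewrite cI cS.
exists (fun x => if x == M then m else g x); split.
- have gm x : x \in S -> x != M -> g x != m.
    move=> xS xM; have : g x \in I :\ m by rewrite -gI imset_f // !inE xM.
    by rewrite !inE => /andP[].
  move=> x y xS yS; case: eqVneq => [->|xM]; case: eqVneq => [->//|yM].
  + by move=> e; have := gm y yS yM; rewrite -e eqxx.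
  + by move=> e; have := gm x xS xM; rewrite e eqxx.
  + by apply: ginj; rewrite !inE ?xM ?yM.
- rewrite -(setD1K MS) imsetU1 eqxx -(setD1K mI) -gI; congr (_ |: _).
  by apply: eq_in_imset => x; rewrite !inE => /andP[/negPf ->].
- move=> x xS; case: eqVneq => [->//|xM]; apply: gle.
  by rewrite !inE xM.
Qed.

Lemma below_of_set_le I S : set_le I S ->
  exists2 f : 'I_#|S| -> 'I_n, below f & f @: setT = I.
Proof.
move=> /set_le_matching[g [ginj gI gle]]; exists (fun r => g (enum_val r)).
  split=> [r r' e|r]; last exact: gle (enum_valP r).
  by apply: enum_val_inj; apply: ginj e; exact: enum_valP.
rewrite -gI; apply/setP => y; apply/imsetP/imsetP => [[r _ ->]|[x xS ->]].
  by exists (enum_val r); rewrite ?enum_valP.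
by exists (enum_rank_in xS x); rewrite ?enum_rankK_in.
Qed.

Lemma set_le_of_below S (f : 'I_#|S| -> 'I_n) : below f -> set_le (f @: setT) S.
Proof.
move=> [finj fle]; split=> [|j]; first by rewrite card_imset // cardsT card_ord.
pose Q := [set r : 'I_#|S| | (enum_val r < j)%N].
have -> : prefix S j = #|Q|.
  rewrite -(card_imset _ enum_val_inj); apply: eq_card => x; rewrite inE.
  apply/andP/imsetP => [[xS xj]|[r + ->]].
    by exists (enum_rank_in xS x); rewrite ?inE enum_rankK_in.
  by rewrite inE => ->; rewrite enum_valP.
rewrite -(card_imset _ finj); apply: subset_leq_card; apply/subsetP => y.
case/imsetP=> r; rewrite inE => rj ->; rewrite inE imset_f //=.
exact: leq_ltn_trans (fle r) rj.
Qed.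

(** Let i be the least element of the symmetric difference, say in I, and j the least element of J
    outside I, so i < j. Replacing j by i in J only lowers J. Replacing i by j in I costs one
    element in the prefixes ending in (i, j]; there the elements of J all lie in I, which also
    contains i, so I has one to spare. *)
Lemma set_le_exchange I J S : set_le I S -> set_le J S -> I <> J ->
  exists i j, [/\ i \in I, j \notin I, j \in J, i \notin J
    & set_le (j |: I :\ i) S /\ set_le (i |: J :\ j) S].
Proof.
have card_swap (A : {set 'I_n}) x y : x \in A -> y \notin A -> #|y |: A :\ x| = #|A|.
  move=> xA yA; rewrite cardsU1 !inE (negPf yA) andbF (cardsD1 x A) xA.
  by rewrite add1n.
have prefix_swap (A : {set 'I_n}) x y j : x \in A -> y \notin A ->
    (prefix (y |: A :\ x) j + (x < j) = prefix A j + (y < j))%N.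
  move=> xA yA; rewrite prefixU1 ?inE ?(negPf yA) ?andbF // (prefixD1 j xA).
  by lia.
have main A B : set_le A S -> set_le B S -> forall i, i \in A -> i \notin B ->
    (forall x : 'I_n, (x < i)%N -> (x \in A) = (x \in B)) ->
    exists j, [/\ j \notin A, j \in B
      & set_le (j |: A :\ i) S /\ set_le (i |: B :\ j) S].
  move=> [cA leA] [cB leB] i iA iB imin.
  have [j0 j0P] : exists x, (x \in B) && (x \notin A).
    apply: contrapT => nj; have /subsetP BA : B \subset A.
      apply/subsetP => x xB; apply: contrapT => /negP xA; apply: nj; exists x.
      by rewrite xB.
    have : B \proper A by apply/properP; split; [apply/subsetP|exists i].
    by move/proper_card; rewrite cA cB ltnn.
  have [j /andP[jB jA] jmin] := 
    arg_minnP (P := fun x => (x \in B) && (x \notin A)) (fun x : 'I_n => x : nat) j0P.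
  have ij : (i < j)%N.
    rewrite ltnNge leq_eqVlt negb_or; apply/andP; split.
      by apply: contraNneq jA => /val_inj ->.
    by apply: contraNN jA => /imin ->.
  exists j; split=> //; split; split; rewrite ?card_swap // => x.
    have e := prefix_swap A i j x iA jA; have := leA x.
    have [xi|ix] := leqP x i; first by lia.
    have [xj|jx] := leqP x j; last by lia.
    have := leB x; suff : (prefix B x < prefix A x)%N by lia.
    apply: proper_card; apply/properP; split; last first.
      by exists i; rewrite !inE ?iA // (negPf iB).
    apply/subsetP => y; rewrite !inE => /andP[yB yx]; rewrite yx andbT.
    apply: contraT => yA; have := jmin y; rewrite yB yA => /(_ isT).
    by rewrite leqNgt (leq_trans yx xj).
  have e := prefix_swap B j i x jB iB; have := leB x.
  by move: ij e; case: (ltnP i x); case: (ltnP j x); lia.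
move=> IS JS /eqP; rewrite eqEsubset negb_and => IJ.
have [x0 x0P] : exists x, (x \in I) != (x \in J).
  case/orP: IJ => /subsetPn[x xa xb]; exists x; rewrite xa (negPf xb) //.
have [x xP xmin] := 
  arg_minnP (P := fun x => (x \in I) != (x \in J)) (fun x : 'I_n => x : nat) x0P.
have eqlt (y : 'I_n) : (y < x)%N -> (y \in I) = (y \in J).
  by move=> yx; apply: contraTeq yx => /xmin; rewrite -leqNgt.
have [xI|xI] := boolP (x \in I).
  have xJ : x \notin J by move: xP; rewrite xI; case: (x \in J).
  by have [j [? ? []]] := main I J IS JS x xI xJ eqlt; exists x, j.
have xJ : x \in J by move: xP; rewrite (negPf xI); case: (x \in J).
have [|i [? ? []]] := main J I JS IS x xJ xI; last by exists i, x.
by move=> y /eqlt.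
Qed.

(** * Least intersection of a matroid basis with a given set *)

Definition initial A (m : nat) := [set x in A | (prefix A x < m)%N].

Lemma prefix_initial A m j : (j <= n)%N ->
  prefix (initial A m) j = minn m (prefix A j).
Proof.
elim: j => [|j IH] jn; first by rewrite !prefix0 minn0.
rewrite !(prefixS _ (Ordinal jn)) /= IH ?(ltnW jn) // inE.
by case: (_ \in A) => /=; rewrite ?addn0 //; lia.
Qed.

(** This is the minimum of #|I :&: T| over all I with [set_le I S], by [min_meet_le] and
    [min_meet_witness]. Truncation is harmless because j = 0 contributes 0. *)
Definition min_meet S T := \max_(j < n.+1) (prefix S j - prefix (~: T) j).

Lemma min_meet_ge S T j : (j <= n)%N -> (prefix S j <= min_meet S T + prefix (~: T) j)%N.
Proof.
move=> jn; rewrite addnC -leq_subLR.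
exact: (@bigop.leq_bigmax _ (fun j : 'I_n.+1 => prefix S j - prefix (~: T) j)%N
  (Ordinal (jn : j < n.+1)%N)).
Qed.

Lemma min_meet_attained S T : exists2 j, (j <= n)%N &
  prefix S j = (min_meet S T + prefix (~: T) j)%N.
Proof.
have [j jE] := @bigop.eq_bigmax _ (fun j : 'I_n.+1 => prefix S j - prefix (~: T) j)%N
  ltac:(by rewrite card_ord).
rewrite -/(min_meet S T) in jE.
have [j0|j0] := posnP (min_meet S T); last by exists j; [rewrite -ltnS|lia].
by exists 0%N => //; rewrite j0 !prefix0.
Qed.

(** I has at least [prefix S j] elements before j, and at most [prefix (~: T) j] of them avoid T. *)
Lemma min_meet_le I S T : set_le I S -> (min_meet S T <= #|I :&: T|)%N.
Proof.
move=> [_ le]; apply/bigmax_leqP => j _; rewrite leq_subLR.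
apply: leq_trans (le j) _.
have -> : prefix I j = (prefix (I :\: T) j + prefix (I :&: T) j)%N.
  rewrite /prefix -(cardsID T [set x in I | (x < j)%N]) addnC.
  by congr (_ + _)%N; apply: eq_card => x; rewrite !inE; case: (x \in T);
     rewrite //= ?andbT ?andbF.
apply: leq_add; last exact: prefix_card.
by apply: subset_leq_card; apply/subsetP => x; rewrite !inE -andbA => /and3P[-> _ ->].
Qed.

(** I takes the m smallest elements of T and the k - m smallest outside T. Let i be an index
    attaining the maximum. For j >= i at least m elements of T precede j; for j <= i at most k - m
    elements outside T do. So in each range one of the two minima in [pI] is known. *)
Lemma min_meet_witness S T : exists2 I, set_le I S & #|I :&: T| = min_meet S T.
Proof.
set m := min_meet S T; pose k := #|S|.
have [i iN mi] := min_meet_attained S T; rewrite -/m in mi.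
pose I := initial T m :|: initial (~: T) (k - m).
have pI j : (j <= n)%N -> prefix I j =
    (minn m (prefix T j) + minn (k - m) (prefix (~: T) j))%N.
  move=> jn; rewrite -!prefix_initial //.
  rewrite /prefix -(cardsID T [set x in I | _]); congr (_ + _)%N.
    apply: eq_card => x; rewrite !inE; case: (x \in T);
     rewrite //= ?andbT ?andbF ?orbF //.
  by apply: eq_card => x; rewrite !inE; case: (x \in T);
     rewrite //= ?andbT ?andbF ?orbF.
have IT : #|I :&: T| = minn m #|T|.
  rewrite -(prefix_full T (leqnn n)) -prefix_initial // prefix_full //.
  by apply: eq_card => x; rewrite !inE; case: (x \in T); rewrite ?andbT ?andbF ?orbF.
have mk : (m <= k)%N by have := prefix_card S i; lia.
have := prefixC T iN; have := prefixC T (leqnn n).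
have := min_meet_ge S T (leqnn n); rewrite !(prefix_full _ (leqnn n)) -/m -/k.
have := prefix_card T i => h1 h2 h3 h4.
have mT : (m <= #|T|)%N.
  by have := prefix_le S iN; have := prefix_le T iN; have := prefixC S iN; lia.
exists I; last by rewrite IT; lia.
have cI : #|I| = k.
  by rewrite -(prefix_full I (leqnn n)) pI // !(prefix_full _ (leqnn n)); lia.
split=> // j; have [jn|nj] := leqP j n; last first.
  by rewrite (prefix_full S (ltnW nj)) (prefix_full I (ltnW nj)) cI.
have := min_meet_ge S T jn; rewrite pI // -/m => h5.
have := prefixC T jn; have := prefixC S jn; have := prefix_card S j; rewrite -/k.
have [ij|ji] := leqP i j.
  have := prefix_le T ij; have := prefix_le (~: T) ij.
  by have := prefix_card S i; have := prefixC S iN; rewrite -/k; lia.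
have := prefix_le T (ltnW ji); have := prefix_le (~: T) (ltnW ji).
by have := prefix_card S i; have := prefixC S iN; rewrite -/k; lia.
Qed.
End Bruhat.

(** * The tropical Pluecker relation *)

Lemma argmax_between (G : nat -> int) l u : (l <= u)%N ->
  exists2 j, (l <= j <= u)%N & forall k, (l <= k <= u)%N -> G k <= G j.
Proof.
move=> /subnK <-; elim: (u - l)%N => [|d [j jlu jmax]].
  by exists l; rewrite ?add0n ?leqnn // => k; rewrite -eqn_leq => /eqP ->.
have [Gd|Gd] := leP (G j) (G (d.+1 + l)%N).
  exists (d.+1 + l)%N => [|k klu]; first by lia.
  have [->//|kd] := eqVneq k (d.+1 + l)%N.
  by apply: le_trans (jmax k _) Gd; lia.
exists j => [|k klu]; first by lia.
have [->|kd] := eqVneq k (d.+1 + l)%N; first exact: ltW.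
by apply: jmax; lia.
Qed.

(** In the application n0, ..., n3 are the maxima of G over the four intervals cut out by a, b, c.
    The flags w1, w2, w3 tell which of a, b, c joins X, which raises G by 1 beyond that point. The
    last two clauses describe the maxima when one side of the minimum is not attained. *)
Lemma tropical_pluecker (n0 n1 n2 n3 : int) (F := fun w1 w2 w3 : int =>
    Num.max (Num.max n0 (n1 + w1)) (Num.max (n2 + w1 + w2) (n3 + w1 + w2 + w3))) :
  [/\ F 0 1 0 + F 1 0 1 = Num.min (F 1 0 0 + F 0 1 1) (F 1 1 0 + F 0 0 1),
      F 0 1 0 + F 1 0 1 < F 1 0 0 + F 0 1 1 -> [/\ n0 <= n1, n2 < n1 & n1 = n3 + 1]
    & F 0 1 0 + F 1 0 1 < F 1 1 0 + F 0 0 1 -> [/\ n1 <= n2, n3 < n2 & n0 = n2 + 1]].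
Proof.
by rewrite /F {F}; split; [lia | move=> ?; split; lia | move=> ?; split; lia].
Qed.

Lemma step_weight (a b c : nat) (w1 w2 w3 : bool)
    (W := fun j => (w1 * (a < j) + w2 * (b < j) + w3 * (c < j))%N) :
  (a < b)%N -> (b < c)%N ->
  [/\ forall j, (j <= a)%N -> W j = 0%N, forall j, (a < j <= b)%N -> W j = w1,
      forall j, (b < j <= c)%N -> W j = (w1 + w2)%N
    & forall j, (c < j)%N -> W j = (w1 + w2 + w3)%N].
Proof.
move=> ab bc; have lt_false (x y : nat) : (y <= x)%N -> (x < y)%N = false.
  by rewrite ltnNge => ->.
rewrite /W; split=> j.
- move=> ja; have jb := leq_trans ja (ltnW ab).
  by rewrite !lt_false ?(leq_trans jb (ltnW bc)) // !muln0.
- case/andP=> -> jb; rewrite !lt_false ?(leq_trans jb (ltnW bc)) //.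
  by rewrite !muln0 muln1 !addn0.
- by case/andP=> bj jc; rewrite (ltn_trans ab bj) bj lt_false // muln0 !muln1 addn0.
- by move=> cj; have bj := ltn_trans bc cj; rewrite (ltn_trans ab bj) bj cj !muln1.
Qed.

Section MVRelation.
Variables (n : nat) (S X : {set 'I_n}) (a b c : 'I_n).
Hypotheses (aX : a \notin X) (bX : b \notin X) (cX : c \notin X).
Hypotheses (ab : (a < b)%N) (bc : (b < c)%N).

Let G j : int := (prefix S j)%:Z - (prefix (~: X) j)%:Z.

(** The shape of G when the first term of the minimum is not attained; [peak_right] is the same for
    the second term. *)
Definition peak_left := exists j1 j3,
  [/\ (a < j1 <= b)%N, (c < j3 <= n)%N, forall j, (j <= a)%N -> G j <= G j1,
      forall j, (b < j <= c)%N -> G j < G j1 & G j1 = G j3 + 1].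

Definition peak_right := exists j0 j2,
  [/\ (j0 <= a)%N, (b < j2 <= c)%N, forall j, (a < j <= b)%N -> G j <= G j2,
      forall j, (c < j <= n)%N -> G j < G j2 & G j0 = G j2 + 1].

Lemma prefixC_U1 (Y : {set 'I_n}) y j : y \notin Y ->
  (prefix (~: Y) j = (y < j) + prefix (~: (y |: Y)) j)%N.
Proof.
move=> yY; rewrite (@prefixD1 _ (~: Y) y) ?inE //; congr (_ + prefix _ _)%N.
by apply/setP => x; rewrite !inE negb_or.
Qed.

Let h := min_meet S.

Lemma mv_relation :
  let lhs := (h (b |: X) + h (X :|: [set a; c]))%N in
  let rhs1 := (h (a |: X) + h (X :|: [set b; c]))%N in
  let rhs2 := (h (X :|: [set a; b]) + h (c |: X))%N in
  [/\ lhs = minn rhs1 rhs2, (lhs < rhs1)%N -> peak_left & (lhs < rhs2)%N -> peak_right].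
Proof.
have [cb cc] : c != b /\ c != a.
  by split; apply: contraTneq bc => ->; rewrite -leqNgt // ltnW.
have ba : b != a by apply: contraTneq ab => ->; rewrite ltnn.
have cn := ltn_ord c.
have [j0 r0 m0] := argmax_between G (leq0n a).
have [j1 r1 m1] := argmax_between G ab.
have [j2 r2 m2] := argmax_between G bc.
have [j3 r3 m3] := argmax_between G cn.
pose F (w1 w2 w3 : int) := Num.max (Num.max (G j0) (G j1 + w1))
  (Num.max (G j2 + w1 + w2) (G j3 + w1 + w2 + w3)).
(* The correction W is constant on each of the four intervals, so the maximum defining h T is
   reached at one of j0, ..., j3. *)
have hF (w1 w2 w3 : bool) (T : {set 'I_n}) :
    (forall j, prefix (~: X) j =
       w1 * (a < j) + w2 * (b < j) + w3 * (c < j) + prefix (~: T) j)%N ->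
    (h T)%:Z = F w1 w2 w3.
  pose W j := (w1 * (a < j) + w2 * (b < j) + w3 * (c < j))%N => qE.
  have [W0 W1 W2 W3] := step_weight w1 w2 w3 ab bc.
  have le j : (j <= n)%N -> G j + (W j)%:Z <= (h T)%:Z.
    by move=> jn; have := min_meet_ge S T jn; rewrite /G qE -/h -/(W j); lia.
  have [j jn jE] := min_meet_attained S T.
  have {}jE : G j + (W j)%:Z = (h T)%:Z.
    by rewrite /G qE jE -/h -/(W j); lia.
  have := le j0; rewrite /W W0 // => /(_ (leq_trans r0 (ltnW (ltn_ord a)))) h0.
  have := le j1; rewrite /W W1 //.
  move=> /(_ (leq_trans (proj2 (andP r1)) (ltnW (ltn_ord b)))) h1.
  have := le j2; rewrite /W W2 //.
  move=> /(_ (leq_trans (proj2 (andP r2)) (ltnW (ltn_ord c)))) h2.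
  have := le j3; rewrite /W W3 ?(proj1 (andP r3)) // => /(_ (proj2 (andP r3))) h3.
  have : (h T)%:Z <= G j0 \/ (h T)%:Z <= G j1 + w1%:Z \/
      (h T)%:Z <= G j2 + (w1 + w2)%N%:Z \/ (h T)%:Z <= G j3 + (w1 + w2 + w3)%N%:Z.
    rewrite -jE; have [ja|aj] := leqP j a.
      by left; rewrite (W0 j ja : W j = _) addr0; exact: m0.
    have [jb|bj] := leqP j b.
      have jr : (a < j <= b)%N by rewrite aj.
      by right; left; rewrite (W1 j jr : W j = _) lerD2r; exact: m1.
    have [jc|cj] := leqP j c.
      have jr : (b < j <= c)%N by rewrite bj.
      by right; right; left; rewrite (W2 j jr : W j = _) lerD2r; exact: m2.
    by right; right; right; rewrite (W3 j cj : W j = _) lerD2r; apply: m3; rewrite cj.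
  move: h0 h1 h2 h3; rewrite /F; move: (G j0) (G j1) (G j2) (G j3) (h T) => g0 g1 g2 g3 t.
  clear; case: w1; case: w2; case: w3 => /=; lia.
have UC (x y : 'I_n) : X :|: [set x; y] = x |: (y |: X).
  by apply/setP => w; rewrite !inE; case: (w \in X); rewrite ?orbT ?orbF.
have q1 x j : x \notin X -> (prefix (~: X) j = (x < j) + prefix (~: (x |: X)) j)%N.
  exact: prefixC_U1.
have q2 x y j : x != y -> x \notin X -> y \notin X ->
    (prefix (~: X) j = (x < j) + (y < j) + prefix (~: (X :|: [set x; y])) j)%N.
  move=> xy xX yX; rewrite UC (q1 y j yX) (@prefixC_U1 (y |: X) x).
    by rewrite addnA (addnC (x < j)%N).
  by rewrite !inE negb_or xy.
have Ha : (h (a |: X))%:Z = F 1 0 0.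
  by apply: (hF true false false) => j; rewrite (q1 a j aX) mul1n !mul0n !addn0.
have Hb : (h (b |: X))%:Z = F 0 1 0.
  by apply: (hF false true false) => j; rewrite (q1 b j bX) mul1n !mul0n add0n !addn0.
have Hc : (h (c |: X))%:Z = F 0 0 1.
  by apply: (hF false false true) => j; rewrite (q1 c j cX) mul1n !mul0n !add0n.
have Hab : (h (X :|: [set a; b]))%:Z = F 1 1 0.
  apply: (hF true true false) => j.
  by rewrite (@q2 a b j) // ?[a == b]eq_sym // !mul1n mul0n addn0.
have Hac : (h (X :|: [set a; c]))%:Z = F 1 0 1.
  apply: (hF true false true) => j.
  by rewrite (@q2 a c j) // ?[a == c]eq_sym // !mul1n mul0n addn0.
have Hbc : (h (X :|: [set b; c]))%:Z = F 0 1 1.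
  apply: (hF false true true) => j.
  by rewrite (@q2 b c j) // ?[b == c]eq_sym // !mul1n mul0n add0n.
have [tp tl tr] := tropical_pluecker (G j0) (G j1) (G j2) (G j3).
rewrite -!/(F _ _ _) -?Ha -?Hb -?Hc -?Hab -?Hac -?Hbc in tp tl tr.
move=> lhs rhs1 rhs2; split; rewrite /lhs /rhs1 /rhs2.
- by clear -tp; lia.
- move=> lt; have [|n01 n21 n13] := tl; first by clear -lt; lia.
  exists j1, j3; split=> // j jr.
    by apply: le_trans n01; exact: m0.
  by apply: le_lt_trans n21; exact: m2.
- move=> lt; have [|n12 n32 n02] := tr; first by clear -lt; lia.
  exists j0, j2; split=> // j jr.
    by apply: le_trans n12; exact: m1.
  by apply: le_lt_trans n32; exact: m3.
Qed.
End MVRelation.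

(* [prefix S - prefix S'] would increase, decrease and increase again. *)
Lemma separated_peaks n (S S' X : {set 'I_n}) (a b c : 'I_n) :
  elt_le (S :\: S') (S' :\: S) \/ elt_le (S' :\: S) (S :\: S') ->
  peak_left S X a b c -> peak_right S' X a b c -> False.
Proof.
move=> sep [j1 [j3 [j1r j3r le1 lt1 e1]]] [j0 [j2 [j0r j2r le2 lt2 e2]]].
pose del j : int := (prefix S j)%:Z - (prefix S' j)%:Z.
have rise (A B : {set 'I_n}) j k : (j <= k)%N ->
    (prefix A j)%:Z - (prefix B j)%:Z < (prefix A k)%:Z - (prefix B k)%:Z ->
    exists2 x, x \in A :\: B & (j <= x < k)%N.
  move=> jk lt; apply: contrapT => nx.
  have step (Y Z : {set 'I_n}) :
      prefix Y k = (prefix Y j + #|[set x in Y | j <= x < k]|)%N.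
    rewrite /prefix -(cardsID [set x : 'I_n | (x < j)%N] [set x in Y | (x < k)%N]).
    congr (_ + _)%N; apply: eq_card => x; rewrite !inE.
      by case: (ltnP x j) => [xj|_]; rewrite ?andbF // (leq_trans xj jk) !andbT.
    by rewrite -leqNgt andbCA.
  have : (#|[set x in A | j <= x < k]| <= #|[set x in B | j <= x < k]|)%N.
    apply: subset_leq_card; apply/subsetP => x; rewrite !inE => /andP[xA xr].
    rewrite xr andbT; apply: contraT => xB; exfalso; apply: nx; exists x => //.
    by rewrite !inE xA xB.
  by move: lt; rewrite (step A B) (step B A); lia.
(* The term depending on X is common to both functions G and cancels in [del]. *)
have d12 : del j2 < del j1.
  by have := lt1 j2 j2r; have := le2 j1 j1r; rewrite /del; lia.
have d01 : del j0 < del j1.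
  by have := le1 j0 j0r; have := le2 j1 j1r; rewrite /del; lia.
have d23 : del j2 < del j3.
  by have := lt1 j2 j2r; have := lt2 j3 j3r; rewrite /del; lia.
have [x xS xr] : exists2 x, x \in S' :\: S & (j1 <= x < j2)%N.
  by apply: rise; [lia | move: d12; rewrite /del; lia].
have [y yS yr] : exists2 y, y \in S :\: S' & (j0 <= y < j1)%N.
  by apply: rise; [lia | move: d01; rewrite /del; lia].
have [w wS wr] : exists2 w, w \in S :\: S' & (j2 <= w < j3)%N.
  by apply: rise; [lia | move: d23; rewrite /del; lia].
(* Here y < x < w with x in S' :\: S and y, w in S :\: S', which refutes both orders. *)
by case: sep => sep; [have := sep w x wS xS | have := sep x y xS yS]; lia.
Qed.

(** * The Newton polytope *)

(** Lexicographic positivity of (x, y) on a finite set becomes positivity of a single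
    combination. *)
Lemma archimedean_perturbation (R : realType) (T : finType) (P : T -> Prop)
    (x y : T -> R) :
  (forall t, P t -> 0 < x t \/ x t = 0 /\ 0 < y t) ->
  exists N : nat, forall t, P t -> 0 < N%:R * x t + y t.
Proof.
move=> xy; have /choice[N NP] t : exists N : nat, P t -> forall M : nat, (N <= M)%N ->
    0 < M%:R * x t + y t.
  have [Pt|nP] := pselect (P t); last by exists 0%N.
  have [xt|[xt yt]] := xy t Pt; last first.
    by exists 0%N => _ M _; rewrite xt mulr0 add0r.
  exists (Num.bound (`|y t| / x t)) => _ M NM.
  have : `|y t| / x t < M%:R.
    apply: lt_le_trans (archi_boundP _) _; first by rewrite divr_ge0 // ltW.
    by rewrite ler_nat.
  rewrite ltr_pdivrMr // => h; rewrite -[y t]opprK subr_gt0.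
  by apply: le_lt_trans h; rewrite -normrN ler_norm.
exists (\sum_t N t)%N => t Pt; apply: NP => //.
by rewrite (bigD1 t) //= leq_addr.
Qed.

Section Polytope.
Variables (R : realType) (n : nat).
Implicit Types (A : set 'rV[R]_n) (c x y : 'rV[R]_n) (q : 'X_{1..n}).

Definition dot c x := \sum_i c 0 i * x 0 i.

Lemma dot_comb c N (w : 'I_N -> R) (v : 'I_N -> 'rV[R]_n) :
  dot c (\sum_i w i *: v i) = \sum_i w i * dot c (v i).
Proof.
rewrite /dot; under eq_bigr do rewrite summxE mulr_sumr.
rewrite exchange_big; apply: eq_bigr => i _ /=; rewrite mulr_sumr.
by apply: eq_bigr => j _; rewrite mxE mulrCA.
Qed.

Lemma conv_ge A c m x : (forall y, A y -> m <= dot c y) -> conv A x -> m <= dot c x.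
Proof.
move=> Am [N [v [w [Av w0 w1 ->]]]]; rewrite dot_comb -[m]mul1r -w1 mulr_suml.
by apply: ler_sum => i _; apply: ler_wpM2l => //; exact: Am.
Qed.

Lemma sub_conv A x : A x -> conv A x.
Proof.
move=> Ax; exists 1%N, (fun=> x), (fun=> 1); split=> //.
  by rewrite big_ord1.
by rewrite big_ord1 scale1r.
Qed.

(** A weighted mean of numbers bounded below by the minimum reaches it only if every term of nonzero
    weight does. *)
Lemma face_support A c x : face (conv A) c x ->
  exists N (v : 'I_N -> 'rV[R]_n) (w : 'I_N -> R),
    [/\ \sum_i w i = 1, x = \sum_i w i *: v i
      & forall i, w i != 0 -> A (v i) /\ face (conv A) c (v i)].
Proof.
move=> [[N [v [w [Av w0 w1 xE]]]] xmin]; exists N, v, w; split=> // i wi.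
split=> //; split; first exact: sub_conv.
have vmin k : dot c x <= dot c (v k) by exact/xmin/sub_conv.
suff e : dot c (v i) = dot c x.
  by move=> y Py; rewrite -!/(dot _ _) e; exact: xmin.
have : \sum_k w k * (dot c (v k) - dot c x) = 0.
  under eq_bigr do rewrite mulrBr.
  by rewrite sumrB -dot_comb -xE -mulr_suml w1 mul1r subrr.
move=> /psumr_eq0P/(_ i isT)/eqP; rewrite mulf_eq0 (negPf wi) subr_eq0 => h.
by apply/eqP/h => k _; rewrite mulr_ge0 // subr_ge0.
Qed.

Lemma face_unique A c y0 x :
  (forall y, A y -> face (conv A) c y -> y = y0) -> face (conv A) c x -> x = y0.
Proof.
move=> uniq /face_support[N [v [w [w1 -> vf]]]].
rewrite -[RHS]scale1r -w1 scaler_suml; apply: eq_bigr => i _.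
have [->|wi] := eqVneq (w i) 0; first by rewrite !scale0r.
by have [Av fv] := vf i wi; rewrite (uniq _ Av fv).
Qed.

Lemma face_inhabited A c x : face (conv A) c x -> exists2 y, A y & face (conv A) c y.
Proof.
move=> /face_support[N [v [w [w1 _ vf]]]].
have [i wi] : exists i, w i != 0.
  apply: contrapT => nw; move/eqP: w1; rewrite big1 ?(eq_sym 0) ?oner_eq0 // => i _.
  by apply/eqP; apply: contrapT => /negP wi; apply: nw; exists i.
by have [Av fv] := vf i wi; exists (v i).
Qed.

Lemma conv_pair (u v x : 'rV[R]_n) : conv [set u; v]%classic x ->
  exists s, x = u + s *: (v - u).
Proof.
move=> [N [p [w [pP _ w1 ->]]]].
have /choice[s sE] i : exists s, p i = u + s *: (v - u).
  have [->|->] := pP i; first by exists 0; rewrite scale0r addr0.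
  by exists 1; rewrite scale1r addrC subrK.
exists (\sum_i w i * s i); under eq_bigr do rewrite sE scalerDr scalerA.
by rewrite big_split /= -!scaler_suml w1 scale1r.
Qed.

Definition point q : 'rV[R]_n := \row_i (q i)%:R.

Section Support.
Variables (chi : {mpoly int[n]}) (K : finType) (sg : K -> {set 'I_n}).
Local Notation family := {ffun K -> {set 'I_n}}.
Implicit Types (I : family).

Definition admissible I := forall k, set_le (I k) (sg k).

Definition family_weight I : 'X_{1..n} := [multinom \sum_k (i \in I k : nat) | i < n].
Local Notation wt := family_weight.

Hypothesis wt_supp : forall I, admissible I -> chi@_(wt I) != 0.
Hypothesis wt_min : forall q (c : 'I_n -> nat), chi@_q != 0 ->
  exists2 I, admissible I & (\sum_i c i * wt I i <= \sum_i c i * q i)%N.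
Hypothesis supp_deg : forall q q', chi@_q != 0 -> chi@_q' != 0 -> mdeg q = mdeg q'.

Lemma admissible_sg : admissible [ffun k => sg k].
Proof. by move=> k; rewrite ffunE; split. Qed.

(** Scale c by N until its gaps exceed the rounding error, at most the sum of [|x I i|]. Round down
    and add B to get natural coefficients; by equality of degrees the shift B cancels, and [wt_min]
    is contradicted. *)
Lemma not_strictly_smaller c q : chi@_q != 0 ->
  ~ (forall I, admissible I -> dot c (point q) < dot c (point (wt I))).
Proof.
move=> qs lt.
pose x I i : R := (wt I i)%:R - (q i)%:R.
have [I aI|N NP] := @archimedean_perturbation R family admissible
    (fun I => \sum_i c 0 i * x I i) (fun I => - \sum_i `|x I i|).
  left; under eq_bigr do rewrite /x mulrBr.
  rewrite sumrB subr_gt0; have := lt I aI; rewrite /dot.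
  by under eq_bigr do rewrite mxE; under [X in _ < X]eq_bigr do rewrite mxE.
pose f i : int := Num.floor (N%:R * c 0 i).
pose B : nat := (\sum_i absz (f i))%N.
pose c' i : nat := absz (f i + B%:Z).
have c'E i : (c' i)%:R = (f i)%:~R + B%:R :> R.
  have h : 0 <= f i + B%:Z.
    have : (absz (f i) <= B)%N by rewrite /B (bigD1 i) //= leq_addr.
    by lia.
  by rewrite -[(c' i)%:R]/((c' i)%:Z%:~R) gez0_abs // intrD.
have [I aI] := wt_min c' qs; rewrite leqNgt => /negP; apply.
rewrite -(ltr_nat R) -subr_gt0 !natr_sum -sumrB.
under eq_bigr do rewrite !natrM -mulrBr c'E mulrDl -/(x I _).
rewrite big_split /= -mulr_sumr sumrB.
have -> : \sum_i (wt I i)%:R = \sum_i (q i)%:R :> R.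
  by rewrite -!natr_sum -!mdegE (supp_deg (wt_supp aI) qs).
rewrite subrr mulr0 addr0; apply: lt_le_trans (NP I aI) _.
rewrite mulr_sumr -sumrB; apply: ler_sum => i _.
rewrite lerBlDr mulrA -lerBlDl -mulrBl.
have fl : (f i)%:~R <= N%:R * c 0 i by exact: floor_le.
have fg : N%:R * c 0 i < (f i)%:~R + 1.
  by have := floorD1_gt (N%:R * c 0 i); rewrite intrD.
apply: le_trans (ler_norm _) _; rewrite normrM -[leRHS]mul1r ler_wpM2r //.
by rewrite ger0_norm ?subr_ge0 // lerBlDl ltW.
Qed.

(** Otherwise tilting c slightly along d = w0 - q makes q strictly smaller than every family weight:
    at I0 because d has positive square norm, elsewhere because c already does so. *)
Lemma not_unique_minimum c q I0 : chi@_q != 0 -> point q <> point (wt I0) ->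
  dot c (point q) <= dot c (point (wt I0)) ->
  (forall I, admissible I -> dot c (point (wt I0)) <= dot c (point (wt I))) ->
  exists2 I, admissible I & wt I <> wt I0 /\ dot c (point (wt I)) = dot c (point (wt I0)).
Proof.
move=> qs q0 cq cmin; apply: contrapT => no.
pose w0 := point (wt I0); pose d := w0 - point q.
have dotB b (v w : 'rV[R]_n) : dot b (v - w) = dot b v - dot b w.
  by rewrite /dot -sumrB; apply: eq_bigr => i _; rewrite !mxE mulrBr.
have [I aI|N NP] := @archimedean_perturbation R family admissible
    (fun I => dot c (point (wt I) - point q)) (fun I => dot d (point (wt I) - point q)).
  have := cmin I aI; rewrite le_eqVlt => /orP[/eqP e|lt]; last first.
    by left; rewrite dotB subr_gt0; apply: le_lt_trans cq lt.
  have -> : wt I = wt I0 by apply: contrapT => ne; apply: no; exists I.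
  rewrite dotB; case: (ltgtP (dot c (point q)) (dot c (point (wt I0)))) cq => // cq _.
    by left; rewrite subr_gt0.
  right; rewrite cq subrr; split=> //; rewrite -/w0 -/d /dot.
  rewrite lt_neqAle sumr_ge0 ?andbT => [|i _]; last by rewrite -expr2 sqr_ge0.
  apply/eqP => /esym/eqP; rewrite psumr_eq0 => [/allP d0|i _];
    last by rewrite -expr2 sqr_ge0.
  apply: q0; apply/eqP; rewrite eq_sym -subr_eq0; apply/eqP/rowP => i.
  have := d0 i (mem_index_enum _); rewrite mulf_eq0 orbb => /eqP.
  by rewrite -/d => ->; rewrite mxE.
apply: (@not_strictly_smaller (N%:R *: c + d) q qs) => I aI.
have dotD b : dot (N%:R *: c + d) b = N%:R * dot c b + dot d b.
  rewrite /dot mulr_sumr -big_split; apply: eq_bigr => i _ /=.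
  by rewrite !mxE mulrDl mulrA.
by rewrite -subr_gt0 -dotB dotD; exact: NP.
Qed.

Local Notation P := (@newton R n chi).

Lemma newton_point q : chi@_q != 0 -> P (point q).
Proof. by move=> qs; apply: sub_conv; exists q. Qed.

Lemma newton_polytope : is_polytope P.
Proof.
have := wt_supp admissible_sg; rewrite -mcoeff_msupp => m0.
have [N sN] : exists N, size (msupp chi) = N.+1.
  by case: (msupp chi) m0 => // q s _; exists (size s).
exists N, (fun i => point (nth 0%MM (msupp chi) i)); congr conv.
apply/seteqP; split=> [x [q + ->]|x [i _ <-]].
  rewrite -mcoeff_msupp => qs.
  have qi : (index q (msupp chi) < N.+1)%N by rewrite -sN index_mem.
  by exists (Ordinal qi) => //=; rewrite nth_index.
exists (nth 0%MM (msupp chi) i) => //; rewrite -mcoeff_msupp mem_nth //.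
by rewrite sN.
Qed.

Lemma newton_vertex v : is_vertex P v -> forall i, v 0 i \is a Num.int.
Proof.
move=> [c fc] i; have [y [q _ yq] fy] : exists2 y,
    [set x | exists2 a, chi@_a != 0 & x = \row_i (a i)%:R]%classic y & face P c y.
  by apply: (@face_inhabited _ c v); rewrite -/(@newton R n chi) fc.
move: fy; rewrite fc => <-; rewrite yq mxE.
by rewrite intr_nat.
Qed.

Lemma newton_edge u v : is_edge P u v -> exists (i j : 'I_n) (t : R),
  i != j /\ v - u = t *: (delta_mx 0 i - delta_mx 0 j).
Proof.
move=> [uv [c fc]].
have adm0 : (fun I : family => `[< admissible I >]) [ffun k => sg k].
  by apply/asboolP; exact: admissible_sg.
have [I0 /asboolP aI0 I0min] := Order.TotalTheory.arg_minP
  (P := fun I : family => `[< admissible I >])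
  (fun I : family => dot c (point (wt I))) adm0.
have cmin I : admissible I -> dot c (point (wt I0)) <= dot c (point (wt I)).
  by move=> aI; apply: I0min; apply/asboolP.
have cminq q : chi@_q != 0 -> dot c (point (wt I0)) <= dot c (point q).
  move=> qs; rewrite leNgt; apply/negP => lt.
  by apply: (@not_strictly_smaller c q qs) => I aI; apply: lt_le_trans lt (cmin I aI).
have face_wt I : admissible I -> dot c (point (wt I)) = dot c (point (wt I0)) ->
    face P c (point (wt I)).
  move=> aI e; split; first exact/newton_point/wt_supp.
  move=> y Py; rewrite -!/(dot _ _) e; apply: conv_ge Py => _ [q qs ->].
  exact: cminq.
(* If the minimum were reached at a single family weight, the face would be one point, whereas it
   contains u != v. *)
have [I1 aI1 [ne1 e1]] : exists2 I, admissible I &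
    wt I <> wt I0 /\ dot c (point (wt I)) = dot c (point (wt I0)).
  apply: contrapT => no; move/eqP: uv; apply.
  have all0 x : face P c x -> x = point (wt I0).
    apply: face_unique => _ [q qs ->] [_ fq]; apply: contrapT => ne; apply: no.
    apply: (@not_unique_minimum c q) => //.
    by apply: fq; exact/newton_point/wt_supp.
  have fu : face P c u by rewrite fc; apply: sub_conv; left.
  have fv : face P c v by rewrite fc; apply: sub_conv; right.
  by rewrite (all0 u fu) (all0 v fv).
have [k nek] : exists k, I1 k <> I0 k.
  apply: contrapT => no; apply: ne1; congr wt; apply/ffunP => k.
  by apply: contrapT => ne; apply: no; exists k.
have [i [j [iI0 jI0 jI1 iI1 [le0 le1]]]] := set_le_exchange (aI0 k) (aI1 k) (nesym nek).
have ij : i != j by apply: contraNneq jI0 => <-.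
pose swap I (x y : 'I_n) : family := [ffun k' => if k' == k then x |: I k :\ y else I k'].
have swap_adm (I : family) (x y : 'I_n) : admissible I -> set_le (x |: I k :\ y) (sg k) ->
    admissible (swap I x y).
  by move=> aI le k'; rewrite ffunE; case: eqP => [->|].
have swapE (I : family) (x y : 'I_n) : y \in I k -> x \notin I k ->
    point (wt (swap I x y)) = point (wt I) + (delta_mx 0 x - delta_mx 0 y).
  move=> yI xI; apply/rowP => l; rewrite !mxE eqxx /= !mnmE !natr_sum.
  rewrite (bigD1 k) //= [in RHS](bigD1 k) //= ffunE eqxx addrAC.
  congr (_ + _); last first.
    by apply: eq_bigr => k' /negPf kk; rewrite ffunE kk.
  rewrite !inE; case: (eqVneq l x) => [->|lx].
    have -> : x == y = false by apply: contraNF xI => /eqP ->.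
    by rewrite (negPf xI) add0r subr0.
  by case: (eqVneq l y) => [->|ly] /=; rewrite ?yI ?subr0 ?addr0 // sub0r subrr.
have dotD b (w w' : 'rV[R]_n) : dot b (w + w') = dot b w + dot b w'.
  by rewrite /dot -big_split; apply: eq_bigr => l _; rewrite !mxE mulrDr.
have dotd (x y : 'I_n) : dot c (delta_mx 0 x - delta_mx 0 y) = c 0 x - c 0 y.
  have dotE (w : 'I_n) : dot c (delta_mx 0 w) = c 0 w.
    rewrite /dot (bigD1 w) //= big1 => [|l lw]; last first.
      by rewrite mxE (negPf lw) andbF mulr0.
    by rewrite mxE !eqxx mulr1 addr0.
  rewrite -!dotE /dot -sumrB; apply: eq_bigr => l _; rewrite !mxE; ring.
have dot_swap (I : family) (x y : 'I_n) : y \in I k -> x \notin I k ->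
    dot c (point (wt (swap I x y))) = dot c (point (wt I)) + (c 0 x - c 0 y).
  by move=> yI xI; rewrite swapE // dotD dotd.
have a2 := swap_adm _ _ _ aI0 le0; have a3 := swap_adm _ _ _ aI1 le1.
(* The two opposite exchanges change the form by opposite amounts, and neither can go below the
   minimum. Hence the exchanged family stays on the edge and gives its direction. *)
have cij : c 0 j = c 0 i.
  have := cmin _ a2; have := cmin _ a3.
  rewrite !dot_swap // e1 !lerDl !subr_ge0 => h1 h2.
  by apply/eqP; rewrite eq_le h1 h2.
have f2 : face P c (point (wt (swap I0 j i))).
  by apply: face_wt => //; rewrite dot_swap // cij subrr addr0.
have f0 := face_wt _ aI0 erefl.
move: f0 f2; rewrite fc => /conv_pair[s0 E0] /conv_pair[s2]; rewrite swapE // E0.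
rewrite -addrA => /addrI e.
have {}e : delta_mx 0 j - delta_mx 0 i = (s2 - s0) *: (v - u).
  by rewrite scalerBl -e addrC addrK.
have s20 : s2 - s0 != 0.
  apply: contraTneq isT => s20; move: e; rewrite s20 scale0r => /rowP/(_ j).
  rewrite !mxE !eqxx [j == i]eq_sym (negPf ij) subr0 => /eqP.
  by rewrite oner_eq0.
exists j, i, (s2 - s0)^-1; split; first by rewrite eq_sym.
by rewrite e scalerA mulVf // scale1r.
Qed.

Lemma mu_newton T : mu P T = (\sum_k min_meet (sg k) T)%:R.
Proof.
pose c : 'rV[R]_n := \row_i (i \in T)%:R.
have dotc x : dot c x = \sum_(i in T) x 0 i.
  rewrite /dot [RHS]big_mkcond; apply: eq_bigr => i _; rewrite mxE.
  by case: ifP; rewrite ?mul1r ?mul0r.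
have wtT I : (\sum_i (i \in T : nat) * wt I i = \sum_k #|I k :&: T|)%N.
  under eq_bigr do rewrite mnmE big_distrr /=.
  rewrite exchange_big; apply: eq_bigr => k _ /=.
  rewrite -sum1_card [RHS]big_mkcond; apply: eq_bigr => i _; rewrite !inE.
  by case: (i \in T); case: (i \in I k).
have [I aI IT] : exists2 I, admissible I & forall k, #|I k :&: T| = min_meet (sg k) T.
  have /choice[f fP] k : exists J, set_le J (sg k) /\ #|J :&: T| = min_meet (sg k) T.
    by have [J ? ?] := min_meet_witness (sg k) T; exists J.
  exists [ffun k => f k] => k; rewrite ffunE; by case: (fP k).
have lb x : P x -> (\sum_k min_meet (sg k) T)%:R <= \sum_(i in T) x 0 i.
  rewrite -dotc => Px; apply: conv_ge Px => _ [q qs ->].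
  have [J aJ le] := wt_min (fun i => i \in T : nat) qs.
  apply: (@le_trans _ _ (\sum_i (i \in T : nat) * q i)%N%:R).
    rewrite ler_nat; apply: leq_trans le; rewrite wtT; apply: leq_sum => k _.
    exact: min_meet_le.
  by rewrite /dot natr_sum; apply: ler_sum => i _; rewrite !mxE natrM.
have att : \sum_(i in T) point (wt I) 0 i = (\sum_k min_meet (sg k) T)%:R.
  under [in RHS]eq_bigr do rewrite -IT.
  rewrite -wtT -dotc natr_sum; apply: eq_bigr => i _.
  by rewrite !mxE natrM.
have PI := newton_point (wt_supp aI).
apply/eqP; rewrite eq_le; apply/andP; split.
  rewrite -att; apply: ge_inf; last by exists (point (wt I)).
  by exists (\sum_k min_meet (sg k) T)%:R => _ [x Px <-]; exact: lb.
apply: lb_le_inf; first by exists (\sum_(i in T) point (wt I) 0 i), (point (wt I)).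
by move=> _ [x Px <-]; exact: lb.
Qed.

Lemma newton_MV :
  (forall k k', elt_le (sg k :\: sg k') (sg k' :\: sg k) \/
                elt_le (sg k' :\: sg k) (sg k :\: sg k')) ->
  MV_polytope P.
Proof.
move=> sep; split.
  split; last exact: newton_vertex.
  by split; [exact: newton_polytope | exact: newton_edge].
move=> X a b c aX bX cX ab bc; rewrite !mu_newton -!natrD.
have rel k := mv_relation (sg k) aX bX cX ab bc.
rewrite -!big_split /=.
set L := (\sum_k _)%N; set R1 := (\sum_k _)%N; set R2 := (\sum_k _)%N.
have LR1 : (L <= R1)%N.
  by apply: leq_sum => k _; have [-> _ _] := rel k; exact: geq_minl.
have LR2 : (L <= R2)%N.
  by apply: leq_sum => k _; have [-> _ _] := rel k; exact: geq_minr.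
(* If one summand k misses the first term, separation from k makes every summand attain the
   second. *)
have : L = R1 \/ L = R2.
  have [[k lk]|no] := pselect (exists k, (min_meet (sg k) (b |: X) +
      min_meet (sg k) (X :|: [set a; c]) < min_meet (sg k) (a |: X) +
      min_meet (sg k) (X :|: [set b; c]))%N).
    right; apply: eq_bigr => k' _; have [e _ pr] := rel k'.
    apply/eqP; rewrite eqn_leq {1}e geq_minr leqNgt; apply/negP => lk'.
    have [_ pl _] := rel k.
    exact: separated_peaks (sep k k') (pl lk) (pr lk').
  left; apply: eq_bigr => k _; have [e _ _] := rel k.
  apply/eqP; rewrite eqn_leq {1}e geq_minl leqNgt; apply/negP => lk.
  by apply: no; exists k.
case=> <-.
  by rewrite (min_idPl _) // ler_nat.
by rewrite (min_idPr _) // ler_nat.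
Qed.
End Support.
End Polytope.

Theorem theorem3 (R : realType) (n : nat) (D : {mset {set 'I_n}}) :
  strongly_separated D -> MV_polytope (schubitope R D).
Proof.
move=> sep; pose sg (k : copies D) := fsval (tag k).
have wtE (f : forall k : copies D, 'I_#|sg k| -> 'I_n)
    (I : {ffun copies D -> {set 'I_n}}) i :
    (forall k, injective (f k)) -> (forall k, I k = f k @: setT) ->
    family_weight I i = (\sum_k \sum_r (f k r == i : nat))%N.
  move=> finj If; rewrite mnmE; apply: eq_bigr => k _; rewrite If.
  case: imsetP => [[r _ ->]|ni]; last first.
    by rewrite big1 // => r _; case: eqP => // fr; case: ni; exists r.
  rewrite (bigD1 r) //= eqxx big1 // => r' /negPf rr.
  by rewrite (inj_eq (finj k)) rr.
apply: (@newton_MV R n _ (copies D) sg).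
- move=> I aI.
  have /choice_dep[f fP] : forall k : copies D, exists f : 'I_#|sg k| -> 'I_n,
      below f /\ I k = f @: setT.
    by move=> k; have [f bf fI] := below_of_set_le (aI k); exists f.
  have -> : family_weight I = [multinom \sum_k \sum_r (f k r == i : nat) | i < n].
    apply/mnmP => i; rewrite (wtE f) ?mnmE // => k; last by have [] := fP k.
    by have [[]] := fP k.
  by apply: character_lower => k; have [] := fP k.
- move=> q c qs; have [f [fb le]] := character_upper c qs.
  (* [character_upper] makes one choice for each distinct set; all copies of that set use it. *)
  exists [ffun k : copies D => f (tag k) @: setT].
    by move=> k; rewrite ffunE; exact: set_le_of_below.
  apply: leq_trans le; rewrite leq_eqVlt; apply/orP; left; apply/eqP.
  transitivity (\sum_(k : copies D) \sum_r c (f (tag k) r))%N; last first.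
    transitivity (\sum_S \sum_(j < D (fsval S)) \sum_r c (f S r))%N.
      by rewrite [RHS]sig_big_dep.
    by apply: eq_bigr => S _; rewrite sum_nat_const card_ord.
  transitivity (\sum_i \sum_(k : copies D) \sum_r c i * (f (tag k) r == i))%N.
    apply: eq_bigr => i _; rewrite (wtE (fun k => f (tag k))) => [|k|k].
    - by rewrite big_distrr; apply: eq_bigr => k _; rewrite /= big_distrr.
    - by have [] := fb (tag k).
    - by rewrite ffunE.
  rewrite exchange_big; apply: eq_bigr => k _ /=.
  rewrite exchange_big; apply: eq_bigr => r _ /=.
  rewrite (bigD1 (f (tag k) r)) //= eqxx muln1 big1 ?addn0 // => i ir.
  by rewrite eq_sym (negPf ir) muln0.
- by move=> q q' qs qs'; rewrite (character_degree qs) (character_degree qs').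
- move=> k k'; apply: sep; rewrite in_mset lt0n -mem_finsupp; exact: fsvalP.
Qed.
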